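(* (i) Let $\eta(u,v)\in\mathbb{R}[u,v]^d$ be an estimator of the form $$X=\eta(u,v)=\eta(u,0)+\sum_{i=p+1}^{d} v_{i-p}\, e_i(u)+ c\sum_{j=1}^p f_j(u,v)\, e_j(u),\qquad(\mathrm{V}_1)$$ where $c\in\mathbb{R}$; the vectors $e_1(u),\dots,e_d(u)$ have entries in $\mathbb{R}[u]$ and for each $u$ form a basis of $\mathbb{R}^d$ with $e_i(u)^\top\bar G(\eta(u,0))\,\partial_{u^a}\eta(u,0)=0$ for $i=p+1,\dots,d$, $a=1,\dots,p$; and $f_1,\dots,f_p$ are polynomials in $v$, with coefficients in $\mathbb{R}[u]$, all of whose terms have degree at least $2$ in $v$. Then the estimator is first-order efficient. (ii) Every estimator defined by a vector version $(\mathrm{V}_1)$ as in (i) is also represented by an algebraic version: with $\eta_u=\eta(u,0)$, there exist $\tilde e_1,\dots,\tilde e_p\in\mathbb{R}[u,\eta_u]^d$ spanning $((\nabla_u\eta(u,0))^{\perp_{\bar G}})^{\perp_E}$ for every $u$, and $h_j(X,u,\eta_u,t)\in\mathbb{R}[X,u,\eta_u][t]$ ($j=1,\dots,p$) homogeneous of degree $2$ in $t\in\mathbb{R}^d$, such that for all $X$ and $u$ there is $v\in\mathbb{R}^{d-p}$ satisfying $(\mathrm{V}_1)$ if and only if $$(X-\eta_u)^\top\tilde e_j(u,\eta_u)+c\,h_j(X,u,\eta_u,X-\eta_u)=0,\qquad j=1,\dots,p.\qquad(\mathrm{A}_1)$$ (iii) Every algebraic version, i.e. every system $(\mathrm{A}_1)$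 with $c\in\mathbb{R}$, $\tilde e_1,\dots,\tilde e_p\in\mathbb{R}[u,\eta_u]^d$ spanning $((\nabla_u\eta(u,0))^{\perp_{\bar G}})^{\perp_E}$ for every $u$, and $h_j\in\mathbb{R}[X,u,\eta_u][t]$ homogeneous of degree $2$ in $t$, gives a first-order efficient estimator.
   Context: Full exponential family: $dP(x|\theta)=\exp(\sum_i x_i\theta^i-\psi(\theta))\,d\nu$, $x\in\mathbb{R}^d$, $\theta\in\Theta\subset\mathbb{R}^d$, with smooth potential $\psi$. The expectation parameter is $\eta(\theta)=\nabla_\theta\psi(\theta)$, locally invertible. The Fisher metric with respect to $\theta$ is $g_{ij}=\partial^2\psi/\partial\theta^i\partial\theta^j$ (positive definite), and $\bar G(\eta)=(g^{ij})$ is its inverse matrix, the Fisher metric with respect to $\eta$. The model is an algebraic curved exponential family of dimension $p<d$ with expectation parameter space $\mathcal{V}_E\subset\mathbb{R}^d$, nonsingular around the true parameter; here algebraic means that $\mathcal V_E$ or the natural parameter space is a real algebraic variety and the relation between $\theta$ and $\eta$ is locally given by polynomial equations. $u\mapsto\eta(u,0)$, $u$ in a subset of $\mathbb{R}^p$, is a regular parametrization of $\mathcal{V}_E$ around the true parameter. $X\in\mathbb{R}^d$ denotes the sample mean. $(\nabla_u\eta(u,0))^{\perp_{\bar G}}$ is the subspace of $\mathbb{R}^d$ orthogonal, with respect to $\bar G(\eta(u,0))$, to $\mathrm{span}(\partial_{u^a}\eta(u,0))_{a=1}^p$; $(\cdot)^{\perp_E}$ is the Euclidean orthogonal complement. An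 estimator is given by a local coordinate system $(u,v)\in\mathbb{R}^p\times\mathbb{R}^{d-p}$, $(u,v)\mapsto\eta(u,v)\in\mathbb{R}^d$ (smooth), around the true parameter, extending the parametrization $\eta(u,0)$ of $\mathcal{V}_E$; the estimate from $X=\eta(u,v)$ is $u$. The estimator defined by a system of equations in $(X,u)$ is such a coordinate system (with any choice of the coordinates $v$) for which the equations hold identically when $X=\eta(u,v)$ is substituted. The estimator is first-order efficient if and only if the mixed components of the Fisher metric vanish on the model: $$g_{\kappa a}\big|_{v=0}=\left.\left(\frac{\partial\eta(u,v)}{\partial v^\kappa}\right)^{\!\top}\bar G(\eta(u,v))\,\frac{\partial\eta(u,v)}{\partial u^a}\right|_{v=0}=0\quad\text{for all }\kappa\in\{1,\dots,d-p\},\ a\in\{1,\dots,p\};$$ this criterion is taken as the definition. *)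

(* Defs.v *)
From HB Require Import structures.
From mathcomp Require Import all_boot all_order all_algebra.
From mathcomp Require Import all_classical all_reals all_analysis.
From mathcomp.multinomials Require mpoly.
(* A full Import of mpoly clashes with the notations of mathcomp-analysis. *)
Import (canonicals, coercions) mpoly.
Import numFieldNormedType.Exports.

Set Implicit Arguments.
Unset Strict Implicit.
Unset Printing Implicit Defensive.

Import Order.TTheory GRing.Theory Num.Theory.
Local Open Scope classical_set_scope.
Local Open Scope ring_scope.

(* Vectors are row vectors.  The ambient dimension is d = p + q, where p is the
   dimension of the model, and R^d is 'rV_(p + q), so that (u, v) is row_mx u v.
   The library's jacobian f x acts on row vectors from the right: its i-th row
   is the partial derivative of f in the i-th coordinate. *)

Section Smooth.
Context {R : realType} {V W : normedModType R}.

Fixpoint C_on (k : nat) (D : set V) (f : V -> W) : Prop :=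
  if k is k'.+1 then
    (forall x, D x -> differentiable f x) /\ (forall v, C_on k' D ('D_v f))
  else forall x, D x -> {for x, continuous f}.

Definition smooth_on (D : set V) (f : V -> W) : Prop := forall k, C_on k D f.

End Smooth.

Section ExponentialFamily.
Context {R : realType} {d : nat}.

Definition borel_rV := g_sigma_algebraType [set A : set 'rV[R]_d | open A].

Definition grad (psi : 'rV[R]_d -> R) (theta : 'rV[R]_d) : 'rV[R]_d :=
  \row_i 'D_(delta_mx 0 i) psi theta.

Definition fisher (psi : 'rV[R]_d -> R) (theta : 'rV[R]_d) : 'M[R]_d :=
  \matrix_(i, j) 'D_(delta_mx 0 i) ('D_(delta_mx 0 j) psi) theta.

Definition posdef (A : 'M[R]_d) : Prop :=
  forall x : 'rV[R]_d, x != 0 -> 0 < (x *m A *m x^T) 0 0.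

Record full_exponential_family (nu : {measure set borel_rV -> \bar R})
    (Theta : set 'rV[R]_d) (psi : 'rV[R]_d -> R) : Prop := {
  natural_open : open Theta;
  density_normalized : forall theta, Theta theta ->
    (\int[nu]_x
      (expR (\sum_i (x : 'rV[R]_d) 0 i * theta 0 i - psi theta))%:E = 1)%E;
  potential_smooth : smooth_on Theta psi;
  fisher_posdef : forall theta, Theta theta -> posdef (fisher psi theta) }.

(* The inverse of theta |-> eta = grad psi theta.  For a full exponential
   family the positive definiteness of the Fisher metric makes psi strictly
   convex, so grad psi is injective on Theta and its pseudo-inverse is the
   inverse on the whole set of expectation parameters. *)
Definition theta_of (Theta : set 'rV[R]_d) (psi : 'rV[R]_d -> R) :
    'rV[R]_d -> 'rV[R]_d :=
  'pinv_(fun=> 0) Theta (grad psi).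

Definition Gbar (Theta : set 'rV[R]_d) (psi : 'rV[R]_d -> R)
    (eta : 'rV[R]_d) : 'M[R]_d :=
  invmx (fisher psi (theta_of Theta psi eta)).

End ExponentialFamily.

Arguments borel_rV : clear implicits.

Section PolynomialMaps.
Context {R : realType}.

Definition ev n (x : 'rV[R]_n) (f : mpoly.mpoly n R) : R :=
  mpoly.meval (x 0) f.

Definition evmx n (x : 'rV[R]_n) m k (A : 'M[mpoly.mpoly n R]_(m, k)) :
    'M[R]_(m, k) :=
  map_mx (ev x) A.

(* Evaluation of f in R[x][t], a polynomial in t whose coefficients are
   polynomials in x. *)
Definition ev2 n m (x : 'rV[R]_n) (t : 'rV[R]_m)
    (f : mpoly.mpoly m (mpoly.mpoly n R)) : R :=
  mpoly.mmap (ev x) (t 0) f.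

Definition order_ge n m (k : nat) (f : mpoly.mpoly m (mpoly.mpoly n R)) :
    Prop :=
  forall mon, mon \in mpoly.msupp f -> (k <= mpoly.mdeg mon)%N.

Definition homogeneous n m (k : nat) (f : mpoly.mpoly m (mpoly.mpoly n R)) :
    Prop :=
  f \is mpoly.ishomog1 k (@mpoly.mdeg m).

Definition zeros n (s : seq (mpoly.mpoly n R)) : set 'rV[R]_n :=
  [set x | forall f, f \in s -> ev x f = 0].

Definition real_variety n (D V : set 'rV[R]_n) : Prop :=
  exists s : seq (mpoly.mpoly n R), V = D `&` zeros s.

(* x is a nonsingular point, of codimension q, of the algebraic set V: the
   Jacobian criterion. *)
Definition nonsingular_at n (q : nat) (V : set 'rV[R]_n) (x : 'rV[R]_n) :
    Prop :=
  V x /\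
  exists f : 'I_q -> mpoly.mpoly n R,
    (\forall y \near x, V y <-> (forall k, ev y (f k) = 0)) /\
    row_free (\matrix_(k < q, i < n) ev x (mpoly.mderiv i (f k))).

End PolynomialMaps.

Section CurvedFamily.
Context {R : realType} {p q : nat}.
Local Notation d := (p + q)%N.
Implicit Types (Theta VE : set 'rV[R]_d) (psi : 'rV[R]_d -> R).
Implicit Types (U : set 'rV[R]_p) (u : 'rV[R]_p) (v : 'rV[R]_q).

(* VE is the set of expectation parameters of the model and VN the set of its
   natural parameters; eta_true is the true parameter. *)
Definition algebraic_curved_family Theta psi VE (eta_true : 'rV[R]_d) : Prop :=
  let E := grad psi @` Theta in
  let VN := Theta `&` grad psi @^-1` VE in
  let theta_true := theta_of Theta psi eta_true in
  [/\ VE `<=` E, VE eta_true,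
      (real_variety E VE /\ nonsingular_at q VE eta_true) \/
      (real_variety Theta VN /\ nonsingular_at q VN theta_true) &
      exists s : seq (mpoly.mpoly (d + d) R),
        \forall theta \near theta_true & eta \near eta_true,
          VN theta -> VE eta ->
          (eta = grad psi theta <-> zeros s (row_mx theta eta))].

(* The last clause says that eta0 is a homeomorphism onto its image and that
   this image is a neighbourhood, in VE, of each of its points. *)
Record regular_parametrization VE U (eta0 : 'rV[R]_p -> 'rV[R]_d) : Prop := {
  param_open : open U;
  param_smooth : smooth_on U eta0;
  param_immersion : forall u, U u -> row_free (jacobian eta0 u);
  param_inj : set_inj U eta0;
  param_onto : forall O, open O -> O `<=` U ->
    exists W : set 'rV[R]_d, open W /\ eta0 @` O = VE `&` W }.

(* A local coordinate system around the true parameter eta0 u0, on the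
   coordinate domain D. *)
Record estimator U (u0 : 'rV[R]_p) (eta0 : 'rV[R]_p -> 'rV[R]_d)
    (D : set 'rV[R]_d) (eta : 'rV[R]_d -> 'rV[R]_d) : Prop := {
  estimator_open : open D;
  estimator_true : D (row_mx u0 0);
  estimator_dom : forall u v, D (row_mx u v) -> U u;
  estimator_smooth : smooth_on D eta;
  estimator_inj : set_inj D eta;
  estimator_jacobian : forall w, D w -> jacobian eta w \in unitmx;
  estimator_extends :
    forall u, D (row_mx u 0) -> eta (row_mx u 0) = eta0 u }.

(* The component g_{k a} of the Fisher metric in the coordinates w = (u, v). *)
Definition fisher_mixed Theta psi (eta : 'rV[R]_d -> 'rV[R]_d) (w : 'rV[R]_d)
    (k : 'I_q) (a : 'I_p) : R :=
  ('D_(delta_mx 0 (rshift p k)) eta w *m Gbar Theta psi (eta w)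
     *m ('D_(delta_mx 0 (lshift q a)) eta w)^T) 0 0.

Definition first_order_efficient Theta psi (D : set 'rV[R]_d)
    (eta : 'rV[R]_d -> 'rV[R]_d) : Prop :=
  forall u, D (row_mx u 0) ->
  forall k a, fisher_mixed Theta psi eta (row_mx u 0) k a = 0.

(* Subspaces of R^d are row spaces of matrices. *)
Definition orthG m (G : 'M[R]_d) (A : 'M[R]_(m, d)) : 'M[R]_d :=
  kermx (G *m A^T).
Definition orthE m (A : 'M[R]_(m, d)) : 'M[R]_d := kermx A^T.

(* The row space of this matrix is the Euclidean orthogonal complement of the
   Gbar-orthogonal complement of the tangent space of the model at eta0 u. *)
Definition cotangent Theta psi (eta0 : 'rV[R]_p -> 'rV[R]_d) u : 'M[R]_d :=
  orthE (orthG (Gbar Theta psi (eta0 u)) (jacobian eta0 u)).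

(* The vector version of an estimator: H is the polynomial vector eta(u, 0), the
   rows of e are the vectors e_1, ..., e_d, and the last q of them are the ones
   orthogonal to the model. *)
Definition vector_version (H : 'rV[mpoly.mpoly p R]_d)
    (e : 'M[mpoly.mpoly p R]_d) (c : R)
    (f : 'I_p -> mpoly.mpoly q (mpoly.mpoly p R)) u v : 'rV[R]_d :=
  evmx u H + \sum_(k < q) v 0 k *: row (rshift p k) (evmx u e)
    + c *: \sum_(j < p) ev2 u v (f j) *: row (lshift q j) (evmx u e).

Definition vector_version_map H e c f (w : 'rV[R]_d) : 'rV[R]_d :=
  vector_version H e c f (lsubmx w) (rsubmx w).

Record vector_data Theta psi U (eta0 : 'rV[R]_p -> 'rV[R]_d)
    (H : 'rV[mpoly.mpoly p R]_d) (e : 'M[mpoly.mpoly p R]_d)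
    (f : 'I_p -> mpoly.mpoly q (mpoly.mpoly p R)) : Prop := {
  vector_model : forall u, U u -> evmx u H = eta0 u;
  vector_basis : forall u, U u -> evmx u e \in unitmx;
  vector_orth : forall u, U u -> forall (k : 'I_q) (a : 'I_p),
    row (rshift p k) (evmx u e) *m Gbar Theta psi (eta0 u)
      *m ('D_(delta_mx 0 a) eta0 u)^T = 0;
  vector_order : forall j, order_ge 2 (f j) }.

(* Coefficients of the algebraic version: the rows of et are the polynomial vectors
   e~_j in R[u, eta_u]^d, and h_j is in R[X, u, eta_u][t]. *)
Record algebraic_data Theta psi U (eta0 : 'rV[R]_p -> 'rV[R]_d)
    (et : 'M[mpoly.mpoly (p + d) R]_(p, d))
    (h : 'I_p -> mpoly.mpoly d (mpoly.mpoly (d + (p + d)) R)) : Prop := {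
  algebraic_span : forall u, U u ->
    (evmx (row_mx u (eta0 u)) et :=: cotangent Theta psi eta0 u)%MS;
  algebraic_homogeneous : forall j, homogeneous 2 (h j) }.

Definition algebraic_version (eta0 : 'rV[R]_p -> 'rV[R]_d)
    (et : 'M[mpoly.mpoly (p + d) R]_(p, d)) (c : R)
    (h : 'I_p -> mpoly.mpoly d (mpoly.mpoly (d + (p + d)) R))
    (X : 'rV[R]_d) u : Prop :=
  let eta_u := eta0 u in
  forall j : 'I_p,
    ((X - eta_u) *m (row j (evmx (row_mx u eta_u) et))^T) 0 0
    + c * ev2 (row_mx X (row_mx u eta_u)) (X - eta_u) (h j) = 0.

Definition defined_by_algebraic U u0 eta0 et c h D eta : Prop :=
  estimator U u0 eta0 D eta /\
  forall u v, D (row_mx u v) ->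
    algebraic_version eta0 et c h (eta (row_mx u v)) u.

End CurvedFamily.

(* Main.v *)
Require Import Defs.
From HB Require Import structures.
From mathcomp Require Import all_boot all_order all_algebra.
From mathcomp Require Import all_classical all_reals all_analysis.
From mathcomp.multinomials Require mpoly.
Import (canonicals, coercions) mpoly.
From mathcomp Require Import ring lra zify.
Import numFieldNormedType.Exports.
Set Implicit Arguments. Unset Strict Implicit. Unset Printing Implicit Defensive.
Import Order.TTheory GRing.Theory Num.Theory.
Local Open Scope classical_set_scope.
Local Open Scope ring_scope.

(** Write eta_u for eta0 u, J for the jacobian of eta0 at u, whose rows span the
tangent space of the model, and G for Gbar at eta_u.  Since fisher is positive
definite on Theta and theta_of inverts grad psi, G is positive definite.

The space cotangent is the row space of J G^T: the G-orthogonal complement of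
the rows of J is the Euclidean complement of the rows of J G^T, and taking the
Euclidean complement twice does nothing ([orth_orthGE]).  Hence a vector
Euclidean-orthogonal to e~_1, ..., e~_p is G-orthogonal to the model.

Algebraic versions are efficient ([algebraic_efficient]).  Put X = eta(u, v) in
the equations and differentiate in v at v = 0.  As X - eta_u vanishes there and
h_j is quadratic in it, only the linear term is left: the derivative of eta in
v_k is orthogonal to all e~_j.  The derivative in u_a is that of eta0, because
eta(u, 0) = eta_u.  So the mixed components of the metric vanish.

A vector version is an algebraic one ([algebraic_of_vector]).  The matrix e(u)
has an inverse, so (V1) can be solved for its coordinates: if
s = (X - eta_u) e(u)^{-1}, a v exists exactly when s_j = c f_j(u, v) for
j <= p, where v consists of the last q entries of s.  The entries of e(u)^{-1}
are not polynomials, but those of the adjugate are; multiplying the j-th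
equation by a high power of det e(u) clears the denominators without changing
its solutions.  In each monomial of f_j, of degree at least 2, two factors are
kept as the variable t of h_j and the others are evaluated at X - eta_u.
Consequently the efficiency of vector versions is an instance of that of
algebraic versions.

Every algebraic version defines an estimator ([algebraic_estimator]).  Complete
the rows of e~ at u0 to a basis by vectors n_1, ..., n_q and impose, besides
the p equations of the algebraic version, the equations
(X - eta_u) n_k^T = v_k.  At the true parameter the derivative in X of this
system of d equations is that basis, so an implicit function theorem yields a
smooth solution X(u, v).  By uniqueness X(u, 0) = eta_u; its jacobian at (u0, 0)
is invertible because J E^T is, where E is the matrix of e~
([cotangent_tangent_unitmx]), and therefore X is a local diffeomorphism.

The equations are polynomial in X, in the smooth functions u and eta_u, and in
v, which makes the implicit function theorem elementary
([implicit_polynomial_function]).  Hadamard's lemma for polynomials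
([polyfun_hadamard]) writes a difference of values as a combination of the
differences of the arguments, with polynomial coefficients.  A contraction
argument gives the solution, and the same identity expresses the increments of
X as increments of the parameters times a rational function of X and the
parameters, so that differentiability of every order follows by induction. *)

(** * Algebras of functions and polynomial functions *)

Section FunctionAlgebras.
Context {R : realType}.

(** Polynomial functions, functions continuous at a point and functions of class
C^k on an open set are all of this kind, so that each construction below
(evaluation of polynomials, determinants, adjugates) is treated only once. *)
Record function_algebra (T : Type) (S : (T -> R) -> Prop) : Prop := {
  falg_cst : forall c, S (fun=> c);
  falgD : forall f g, S f -> S g -> S (fun t => f t + g t);
  falgM : forall f g, S f -> S g -> S (fun t => f t * g t) }.

Section Closure.
Context {T : Type} {S : (T -> R) -> Prop}.
Hypothesis HS : function_algebra S.

Lemma falgZ c f : S f -> S (fun t => c * f t).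
Proof. by move=> Sf; apply: (falgM HS) => //; apply: (falg_cst HS). Qed.

Lemma falgN f : S f -> S (fun t => - f t).
Proof.
by move=> /(falgZ (-1)); congr S; apply/funext => t; rewrite mulN1r.
Qed.

Lemma falgB f g : S f -> S g -> S (fun t => f t - g t).
Proof. by move=> Sf /falgN; exact: (falgD HS). Qed.

Lemma falg_sum (I : Type) (r : seq I) (P : pred I) (F : I -> T -> R) :
  (forall i, P i -> S (F i)) -> S (fun t => \sum_(i <- r | P i) F i t).
Proof.
move=> SF; elim: r => [|i r IH].
  have -> : (fun t => \sum_(i <- [::] | P i) F i t) = fun=> 0.
    by apply/funext => t; rewrite big_nil.
  exact: (falg_cst HS).
have -> : (fun t => \sum_(j <- i :: r | P j) F j t) =
    fun t => (if P i then F i t else 0) + \sum_(j <- r | P j) F j t.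
  by apply/funext => t; rewrite big_cons; case: (P i); rewrite ?add0r.
apply: (falgD HS) => //; case: (boolP (P i)) => Pi; first exact: SF.
exact: (falg_cst HS).
Qed.

Lemma falg_prod (I : Type) (r : seq I) (P : pred I) (F : I -> T -> R) :
  (forall i, P i -> S (F i)) -> S (fun t => \prod_(i <- r | P i) F i t).
Proof.
move=> SF; elim: r => [|i r IH].
  have -> : (fun t => \prod_(i <- [::] | P i) F i t) = fun=> 1.
    by apply/funext => t; rewrite big_nil.
  exact: (falg_cst HS).
have -> : (fun t => \prod_(j <- i :: r | P j) F j t) =
    fun t => (if P i then F i t else 1) * \prod_(j <- r | P j) F j t.
  by apply/funext => t; rewrite big_cons; case: (P i); rewrite ?mul1r.
apply: (falgM HS) => //; case: (boolP (P i)) => Pi; first exact: SF.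
exact: (falg_cst HS).
Qed.

Lemma falgX f n : S f -> S (fun t => f t ^+ n).
Proof.
move=> Sf; have := @falg_prod _ (index_iota 0 n) xpredT (fun=> f) (fun _ _ => Sf).
by congr S; apply/funext => t; rewrite prodr_const_nat subn0.
Qed.

Lemma falg_ev n (x : T -> 'rV[R]_n) f :
  (forall i, S (fun t => x t 0 i)) -> S (fun t => ev (x t) f).
Proof.
move=> Sx; rewrite /ev; under eq_fun do rewrite mpoly.mevalE.
apply: falg_sum => m _; apply: falgZ; apply: falg_prod => i _; exact: falgX.
Qed.

Lemma falg_ev2 n m (x : T -> 'rV[R]_n) (y : T -> 'rV[R]_m) f :
  (forall i, S (fun t => x t 0 i)) -> (forall i, S (fun t => y t 0 i)) ->
  S (fun t => ev2 (x t) (y t) f).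
Proof.
move=> Sx Sy; rewrite /ev2 /mpoly.mmap; apply: falg_sum => k _.
apply: (falgM HS); first exact: falg_ev.
by apply: falg_prod => i _; exact: falgX.
Qed.

Lemma falg_det n (M : T -> 'M[R]_n) :
  (forall i j, S (fun t => M t i j)) -> S (fun t => \det (M t)).
Proof.
move=> SM; rewrite /determinant; apply: falg_sum => s _; apply: falgZ.
by apply: falg_prod.
Qed.

Lemma falg_adj n (M : T -> 'M[R]_n) :
  (forall i j, S (fun t => M t i j)) ->
  forall i j, S (fun t => (\adj (M t)) i j).
Proof.
move=> SM i j; under eq_fun do rewrite mxE /cofactor.
apply: falgZ; apply: falg_det => k l; under eq_fun do rewrite !mxE.
exact: SM.
Qed.

Lemma falg_mulmx m n k (M : T -> 'M[R]_(m, n)) (N : T -> 'M[R]_(n, k)) i j :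
  (forall i j, S (fun t => M t i j)) -> (forall i j, S (fun t => N t i j)) ->
  S (fun t => (M t *m N t) i j).
Proof.
move=> SM SN; under eq_fun do rewrite mxE.
by apply: falg_sum => l _; apply: (falgM HS).
Qed.

Lemma falg_row_mx n m (x : T -> 'rV[R]_n) (y : T -> 'rV[R]_m) i :
  (forall i, S (fun t => x t 0 i)) -> (forall i, S (fun t => y t 0 i)) ->
  S (fun t => (row_mx (x t) (y t)) 0 i).
Proof.
move=> Sx Sy; case: (split_ordP i) => j ->.
  by under eq_fun do rewrite row_mxEl; exact: Sx.
by under eq_fun do rewrite row_mxEr; exact: Sy.
Qed.

End Closure.

(** An inductive definition, because both Hadamard's lemma and the stability of
function algebras under composition with polynomials go by induction on how the
function is built. *)
Inductive polyfun n : ('rV[R]_n -> R) -> Prop :=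
| polyfun_cst c : polyfun (fun=> c)
| polyfun_coord i : polyfun (fun x => x 0 i)
| polyfunD f g : polyfun f -> polyfun g -> polyfun (fun x => f x + g x)
| polyfunM f g : polyfun f -> polyfun g -> polyfun (fun x => f x * g x).

Lemma polyfun_algebra n : function_algebra (@polyfun n).
Proof. by split; [exact: polyfun_cst|exact: polyfunD|exact: polyfunM]. Qed.

Lemma falg_polyfun (T : Type) (S : (T -> R) -> Prop) n (g : 'rV[R]_n -> R)
    (x : T -> 'rV[R]_n) :
  function_algebra S -> polyfun g -> (forall i, S (fun t => x t 0 i)) ->
  S (fun t => g (x t)).
Proof.
move=> HS pg Sx; elim: pg => [c|i|f h _ Sf _ Sh|f h _ Sf _ Sh] //.
- exact: (falg_cst HS).
- exact: (falgD HS).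
- exact: (falgM HS).
Qed.

Lemma continuous_algebra (T : topologicalType) (x : T) :
  function_algebra (fun f : T -> R => {for x, continuous f}).
Proof.
split=> [c|f g cf cg|f g cf cg]; first exact: cvg_cst.
  exact: (cvgD cf cg).
exact: (cvgM cf cg).
Qed.

Lemma polyfun_continuous n (g : 'rV[R]_n -> R) :
  polyfun g -> continuous g.
Proof.
move=> pg x.
have := falg_polyfun (x := id) (continuous_algebra x) pg; apply => i.
exact: coord_continuous.
Qed.

(** On a product, f(y) g(y) - f(x) g(x) = (f(y) - f(x)) g(y) + f(x) (g(y) - g(x)).
The coefficients Q_i are again polynomial, in the pair (y, x). *)
Lemma polyfun_hadamard n (g : 'rV[R]_n -> R) : polyfun g ->
  exists Q : 'I_n -> 'rV[R]_(n + n) -> R, (forall i, polyfun (Q i)) /\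
  forall y x, g y - g x = \sum_i (y 0 i - x 0 i) * Q i (row_mx y x).
Proof.
have pL f : polyfun f -> polyfun (fun z : 'rV[R]_(n + n) => f (lsubmx z)).
  move=> pf; apply: (falg_polyfun (polyfun_algebra _) pf) => i.
  by under eq_fun do rewrite mxE; exact: polyfun_coord.
have pR f : polyfun f -> polyfun (fun z : 'rV[R]_(n + n) => f (rsubmx z)).
  move=> pf; apply: (falg_polyfun (polyfun_algebra _) pf) => i.
  by under eq_fun do rewrite mxE; exact: polyfun_coord.
elim=> [c|i|f h _ [Qf [pQf ef]] _ [Qh [pQh eh]]|f h pf [Qf [pQf ef]] ph [Qh [pQh eh]]].
- exists (fun _ _ => 0); split=> [i|y x]; first exact: polyfun_cst.
  by rewrite subrr big1 // => i _; rewrite mulr0.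
- exists (fun j _ => (i == j)%:R); split=> [j|y x]; first exact: polyfun_cst.
  rewrite (bigD1 i) //= eqxx mulr1 big1 ?addr0 // => j.
  by rewrite eq_sym => /negbTE->; rewrite mulr0.
- exists (fun i z => Qf i z + Qh i z); split=> [i|y x]; first exact: polyfunD.
  under eq_bigr do rewrite mulrDr.
  by rewrite big_split /= -ef -eh; ring.
- exists (fun i z => Qf i z * h (lsubmx z) + f (rsubmx z) * Qh i z).
  split=> [i|y x].
    by apply: polyfunD; apply: polyfunM => //; [exact: pL|exact: pR].
  rewrite row_mxKl row_mxKr.
  under eq_bigr do rewrite mulrDr mulrA mulrCA.
  rewrite big_split /= -mulr_suml -mulr_sumr -ef -eh; ring.
Qed.

End FunctionAlgebras.

(** * Differentiability from products of differences *)

Section DifferentialCriteria.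
Context {R : realType} {V W : normedModType R}.

Lemma differentiable_approx (f : V -> W) x e : differentiable f x -> 0 < e ->
  \forall y \near x, `|f y - f x - 'd f x (y - x)| <= e * `|y - x|.
Proof.
move=> /diff_locally /eqaddoP /(_ e) H e0; have {}H := H e0.
rewrite (near_shift 0); apply: filterS H => h /=.
by rewrite /= !fctE /= subr0 addrK opprD addrA.
Qed.

Lemma approx_differentiable (f : V -> W) x (df : {linear V -> W}) :
  continuous df ->
  (forall e, 0 < e ->
    \forall y \near x, `|f y - f x - df (y - x)| <= e * `|y - x|) ->
  differentiable f x /\ 'd f x = df :> (V -> W).
Proof.
move=> cdf H.
have E : f \o shift x = cst (f x) + df +o_0 id.
  apply/eqaddoP => e e0; have := H e e0; rewrite (near_shift 0).
  by apply: filterS => h /=; rewrite !fctE /= subr0 addrK opprD addrA.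
have dE : 'd f x = df :> (V -> W) by exact: diff_unique.
by split=> //; apply/diff_locallyP; rewrite dE.
Qed.

Lemma differentiable_near_eq (f g : V -> W) x :
  (\near x, f x = g x) -> differentiable f x -> differentiable g x.
Proof.
move=> fg df; have gx := nbhs_singleton fg.
have [] // := @approx_differentiable g x ('d f x).
  exact: diff_continuous.
move=> e e0; have H := differentiable_approx df e0.
by apply: filterS2 fg H => y fgy Hy; rewrite -gx -fgy.
Qed.

End DifferentialCriteria.

Section ProductDifference.
Context {R : realType} {V : normedModType R}.

(** The first factor is O(|y - x|) and the second is o(1). *)
Lemma differentiable_littleo_mul (g n : V -> R) x :
  differentiable g x -> {for x, continuous n} ->
  let k y := (g y - g x) * (n y - n x) in
  differentiable k x /\ forall v, 'D_v k x = 0.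
Proof.
move=> dg cn k.
have [C C0 HC] := linear_lipschitz (diff_continuous dg).
have [dk dkE] : differentiable k x /\ 'd k x = (\0 : {linear V -> R}) :> (V -> R).
  apply: approx_differentiable; first by move=> y; exact: cvg_cst.
  move=> e e0; have Hg := differentiable_approx dg (ltr01 : 0 < 1).
  have C1 : 0 < C + 1 by rewrite addr_gt0.
  have e1 : 0 < e / (C + 1) by rewrite divr_gt0.
  have /cvgrPdist_le /(_ _ e1) Hn := cn.
  near=> y; rewrite /k subrr mul0r !subr0 normrM.
  have gy : `|g y - g x| <= (C + 1) * `|y - x|.
    have h : `|g y - g x - 'd g x (y - x)| <= 1 * `|y - x| by exact: (near Hg y).
    rewrite -[g y - g x](subrK ('d g x (y - x))).
    by rewrite (le_trans (ler_normD _ _)) // mulrDl addrC lerD ?HC ?h.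
  have ny : `|n y - n x| <= e / (C + 1) by rewrite distrC; exact: (near Hn y).
  rewrite (le_trans (ler_pM _ _ gy ny)) // mulrAC mulrCA mulfV ?mulr1 //.
  by rewrite gt_eqF.
by split=> // v; rewrite deriveE // dkE.
Unshelve. all: by end_near. Qed.

(** The coefficients n_i need only be continuous: replacing n_i(y) by n_i(x) costs
a product of differences, which is o(|y - x|).  A factorisation of increments,
such as the one in Hadamard's lemma, thus gives differentiability at once. *)
Lemma product_difference m (f : V -> R) (g n : 'I_m -> V -> R) x :
  (forall i, differentiable (g i) x) -> (forall i, {for x, continuous (n i)}) ->
  (\forall y \near x, f y - f x = \sum_i (g i y - g i x) * n i y) ->
  differentiable f x /\ forall v, 'D_v f x = \sum_i 'D_v (g i) x * n i x.
Proof.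
move=> dg cn H.
pose k i y := (g i y - g i x) * (n i y - n i x).
have dk i : differentiable (k i) x by have [] := differentiable_littleo_mul (dg i) (cn i).
have dk0 i v : 'D_v (k i) x = 0 by have [] := differentiable_littleo_mul (dg i) (cn i).
pose F := cst (f x - \sum_i g i x * n i x) + \sum_i (n i x *: g i + k i).
have fF : \near x, F x = f x.
  apply: filterS H => y /(congr1 (+%R^~ (f x))); rewrite subrK => ->.
  rewrite /F !fctE fct_sumE addrAC [RHS]addrC -addrA; congr (_ + _).
  rewrite addrC -sumrN -big_split; apply: eq_bigr => i _ /=.
  by rewrite /k !fctE /GRing.scale /=; ring.
have dF : differentiable F x.
  apply: differentiableD; first exact: differentiable_cst.
  apply: differentiable_sum => i; apply: differentiableD => //.
  exact: differentiableZ.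
split=> [|v]; first exact: differentiable_near_eq fF dF.
rewrite -(near_eq_derive v fF) /F.
have dD i : derivable (n i x *: g i + k i) x v.
  by apply: diff_derivable; apply: differentiableD => //; exact: differentiableZ.
rewrite deriveD //; last by apply: derivable_sum => i.
rewrite derive_cst add0r derive_sum //; apply: eq_bigr => i _.
have dgi : derivable (g i) x v by exact: diff_derivable.
have dki : derivable (k i) x v by exact: diff_derivable.
rewrite deriveD //; last exact: derivableZ.
by rewrite dk0 addr0 deriveZ // mulrC.
Qed.

End ProductDifference.

(** * Calculus of smooth maps *)

Section SmoothCalculus.
Context {R : realType}.

Lemma C_onW (V W : normedModType R) k (D : set V) (f : V -> W) :
  C_on k.+1 D f -> C_on k D f.
Proof.
elim: k f => [|k IH] f [df Df].
  by move=> x Dx; apply: differentiable_continuous; exact: df.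
by split=> // v; apply: IH; exact: Df.
Qed.

Lemma C_on_sub (V W : normedModType R) k (D E : set V) (f : V -> W) :
  E `<=` D -> C_on k D f -> C_on k E f.
Proof.
move=> ED; elim: k f => [|k IH] f /=; first by move=> cf x /ED; exact: cf.
by move=> [df Df]; split=> [x /ED|v]; [exact: df|apply: IH; exact: Df].
Qed.

Section OpenDomain.
Context {V : normedModType R} {D : set V}.
Hypothesis oD : open D.

Lemma open_near x : D x -> \forall y \near x, D y.
Proof. by move=> Dx; exact: open_nbhs_nbhs. Qed.

(** Openness matters here: derivatives see only the germ of a function. *)
Lemma C_on_eq (W : normedModType R) k (f g : V -> W) :
  (forall x, D x -> f x = g x) -> C_on k D f -> C_on k D g.
Proof.
have near_eq (h1 h2 : V -> W) x : (forall x, D x -> h1 x = h2 x) -> D x ->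
    \near x, h1 x = h2 x.
  by move=> h12 /open_near; apply: filterS => y; exact: h12.
elim: k f g => [|k IH] f g fg /=.
  move=> cf x Dx; rewrite /prop_for /continuous_at -(fg _ Dx).
  by apply: cvg_trans (cf x Dx); apply: near_eq_cvg; exact: near_eq.
move=> [df Df]; split=> [x Dx|v].
  by apply: (differentiable_near_eq _ (df x Dx)); exact: near_eq.
apply: IH (Df v) => x Dx; apply: near_eq_derive; exact: near_eq.
Qed.

Lemma C_on_cst (W : normedModType R) k (c : W) : C_on k D (fun=> c).
Proof.
elim: k c => [|k IH] c /=; first by move=> x _; exact: cvg_cst.
split=> [x _|v]; first exact: differentiable_cst.
have -> : 'D_v (fun=> c : W) = fun _ : V => 0 by apply/funext => x; exact: derive_cst.
exact: IH.
Qed.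

Lemma C_onD k (f g : V -> R) : C_on k D f -> C_on k D g ->
  C_on k D (fun x => f x + g x).
Proof.
elim: k f g => [|k IH] f g /=.
  by move=> cf cg x Dx; exact: (cvgD (cf x Dx) (cg x Dx)).
move=> [df Df] [dg Dg]; split=> [x Dx|v].
  by apply: differentiableD; [exact: df|exact: dg].
apply: (@C_on_eq _ _ (fun x => 'D_v f x + 'D_v g x)) (IH _ _ (Df v) (Dg v)).
by move=> x Dx; rewrite -deriveD //; apply: diff_derivable; [exact: df|exact: dg].
Qed.

Lemma C_onM k (f g : V -> R) : C_on k D f -> C_on k D g ->
  C_on k D (fun x => f x * g x).
Proof.
elim: k f g => [|k IH] f g.
  by move=> cf cg x Dx; exact: (cvgM (cf x Dx) (cg x Dx)).
move=> Cf Cg; have [df Df] := Cf; have [dg Dg] := Cg.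
split=> [x Dx|v].
  by apply: differentiableM; [exact: df|exact: dg].
apply: (@C_on_eq _ _ (fun x => f x * 'D_v g x + g x * 'D_v f x)).
  move=> x Dx; rewrite -[_ * 'D_v g x]/(_ *: _) -[_ * 'D_v f x]/(_ *: _).
  by rewrite -deriveM //; apply: diff_derivable; [exact: df|exact: dg].
by apply: C_onD; apply: IH; [exact: C_onW|exact: Dg|exact: C_onW|exact: Df].
Qed.

Lemma C_on_algebra k : function_algebra (fun f : V -> R => C_on k D f).
Proof. by split; [exact: C_on_cst|exact: C_onD|exact: C_onM]. Qed.

Lemma C_onV k (f : V -> R) : (forall x, D x -> f x != 0) -> C_on k D f ->
  C_on k D (fun x => (f x)^-1).
Proof.
move=> f0; elim: k => [|k IH].
  by move=> cf x Dx; exact: (cvgV (f0 x Dx) (cf x Dx)).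
move=> Cf; have [df Df] := Cf; split=> [x Dx|v].
  by apply: differentiableV; [exact: df|exact: f0].
apply: (@C_on_eq _ _ (fun x => - ((f x)^-1 * (f x)^-1 * 'D_v f x))).
  move=> x Dx; rewrite [RHS](deriveV (f0 x Dx)) /GRing.scale /=.
    by rewrite mulNr expr2 invfM.
  by apply: diff_derivable; exact: df.
have /IH Ci := C_onW Cf.
by apply: (falgN (C_on_algebra k)); apply: C_onM; [exact: C_onM|exact: Df].
Qed.

Lemma differentiable_row n (f : V -> 'rV[R]_n) x :
  (forall i, differentiable (fun y => f y 0 i) x) -> differentiable f x.
Proof.
move=> df.
have -> : f = \sum_i (fun y => f y 0 i *: delta_mx 0 i).
  by apply/funext => y; rewrite fct_sumE {1}[f y]row_sum_delta.
by apply: differentiable_sum => i; exact: differentiableZl.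
Qed.

Lemma derive_coord n (f : V -> 'rV[R]_n) x v i :
  differentiable f x -> ('D_v f x) 0 i = 'D_v (fun y => f y 0 i) x.
Proof. by move=> df; rewrite derive_mx ?mxE //; exact: diff_derivable. Qed.

Lemma differentiable_coord_comp n (f : V -> 'rV[R]_n) x i :
  differentiable f x -> differentiable (fun y => f y 0 i) x.
Proof.
move=> df.
exact: (differentiable_comp (g := fun N : 'rV[R]_n => N 0 i : R) df
          (differentiable_coord _ _ _)).
Qed.

Lemma cvg_row (T : Type) (F : set_system T) {FF : Filter F} n
    (f : T -> 'rV[R]_n) (l : 'rV[R]_n) :
  (forall i, (fun t => f t 0 i) @ F --> l 0 i) -> f @ F --> l.
Proof.
move=> H; apply/cvgrPdist_le => e e0.
have {}H i : \forall t \near F, `|l 0 i - f t 0 i| <= e.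
  by move: e e0; apply/cvgrPdist_le; exact: H.
near=> t; rewrite [leLHS]/Num.Def.normr/= mx_normrE.
apply: bigmax_le => [|[i j] _]; first exact: ltW.
rewrite ord1 !mxE /=; move: j; near: t; exact: filter_forall.
Unshelve. all: by end_near. Qed.

Lemma C_on_row k n (f : V -> 'rV[R]_n) :
  (forall i, C_on k D (fun x => f x 0 i)) <-> C_on k D f.
Proof.
split; elim: k f => [|k IH] f /=.
- by move=> cf x Dx; apply: cvg_row => i; exact: cf.
- move=> Cf; have df x : D x -> differentiable f x.
    by move=> Dx; apply: differentiable_row => i; have [+ _] := Cf i; exact.
  split=> // v; apply: IH => i; have [_ /(_ v)] := Cf i.
  by apply: C_on_eq => x Dx; rewrite derive_coord //; exact: df.
- move=> cf i x Dx; apply: (@continuous_comp _ _ _ f (fun M : 'rV[R]_n => M 0 i)).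
    exact: cf.
  exact: coord_continuous.
- move=> [df Df] i; split=> [x Dx|v].
    by apply: differentiable_coord_comp; exact: df.
  apply: (C_on_eq _ (IH _ (Df v) i)) => x Dx.
  by rewrite derive_coord //; exact: df.
Qed.

End OpenDomain.

Lemma C_on_comp_linear (V V' W : normedModType R) k (D : set V)
    (L : {linear V' -> V}) (f : V -> W) :
  open D -> continuous L -> C_on k D f -> C_on k (L @^-1` D) (fun x => f (L x)).
Proof.
move=> oD cL.
have oL : open (L @^-1` D) by apply: open_comp => // x _; exact: cL.
elim: k f => [|k IH] f.
  by move=> cf x Dx; apply: continuous_comp; [exact: cL|exact: cf].
move=> [df Df]; have dL x : differentiable L x by exact: linear_differentiable.
have dfL x : D (L x) -> differentiable (fun x => f (L x)) x.
  by move=> Dx; apply: (differentiable_comp (g := f)) => //; exact: df.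
split=> // v.
have := IH _ (Df (L v)).
have Eq : forall x, (L @^-1` D) x -> 'D_(L v) f (L x) = 'D_v (fun x => f (L x)) x.
  move=> x Dx; rewrite [RHS]deriveE; last exact: dfL.
  rewrite (diff_comp (g := f)) //; last exact: df.
  by rewrite /= diff_lin // deriveE //; exact: df.
exact: C_on_eq.
Qed.

Lemma C_on_linear (V W : normedModType R) k (D : set V) (L : {linear V -> W}) :
  continuous L -> C_on k D L.
Proof.
move=> cL; case: k => [|k] /=; first by move=> x _; exact: cL.
have dL x : differentiable L x by exact: linear_differentiable.
split=> // v.
have -> : 'D_v L = fun=> L v by apply/funext => x; rewrite deriveE // diff_lin.
exact: C_on_cst.
Qed.

End SmoothCalculus.

(** * The implicit function theorem for polynomial equations *)

HB.instance Definition _ (R : realType) n := Complete.on 'rV[R]_n.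

Section MatrixNorm.
Context {R : realType}.

Lemma mx_norm_leP m n (M : 'M[R]_(m, n)) e : 0 <= e ->
  `|M| <= e <-> forall i j, `|M i j| <= e.
Proof.
move=> e0; rewrite [`|M|]/Num.Def.normr/= mx_normrE; split=> [H i j|H].
  by apply: le_trans H; exact: (le_bigmax _ (fun ij => `|M ij.1 ij.2|) (i, j)).
by apply: bigmax_le => // -[i j] _; exact: H.
Qed.

Lemma mx_entry_le m n (M : 'M[R]_(m, n)) i j : `|M i j| <= `|M|.
Proof. exact: (mx_norm_leP M (normr_ge0 M)).1. Qed.

(** The norm is the maximum of the entries, hence the factor n. *)
Lemma mulmx_norm_le n k (x : 'rV[R]_n) (B : 'M[R]_(n, k)) e : 0 <= e ->
  (forall i j, `|B i j| <= e) -> `|x *m B| <= n%:R * e * `|x|.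
Proof.
move=> e0 Be; apply/mx_norm_leP => [|i j]; first by rewrite !mulr_ge0.
rewrite ord1 mxE (le_trans (ler_norm_sum _ _ _)) //.
apply: (@le_trans _ _ (\sum_(l < n) e * `|x|)).
  by apply: ler_sum => l _; rewrite normrM mulrC ler_pM // mx_entry_le.
by rewrite sumr_const card_ord -mulrA mulr_natl.
Qed.

Lemma row_mx_norm_le m n (x : 'rV[R]_m) (y : 'rV[R]_n) e :
  `|x| <= e -> `|y| <= e -> `|row_mx x y| <= e.
Proof.
move=> xe ye; apply/mx_norm_leP => [|i j].
  exact: le_trans xe.
case: (split_ordP j) => k ->; rewrite ?row_mxEl ?row_mxEr ord1.
  exact: le_trans (mx_entry_le _ _ _) xe.
exact: le_trans (mx_entry_le _ _ _) ye.
Qed.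

(** If x M = 0, the hypothesis reads |x| <= |x| / 2. *)
Lemma contraction_unitmx n (M A : 'M[R]_n) :
  (forall x : 'rV[R]_n, `|x - x *m M *m A| <= 2^-1 * `|x|) -> M \in unitmx.
Proof.
move=> H; rewrite -row_free_unit -kermx_eq0; apply/eqP/row_matrixP => i.
rewrite row0; set x := row i _.
have xM : x *m M = 0 by rewrite /x -row_mul mulmx_ker row0.
have := H x; rewrite xM mul0mx subr0 => h.
apply/eqP; rewrite -normr_le0; move: h (normr_ge0 x); lra.
Qed.

End MatrixNorm.

Lemma derive_coordinate (R : realType) n (x v : 'rV[R]_n) i :
  'D_v (fun y : 'rV[R]_n => y 0 i) x = v 0 i.
Proof.
have := derive_mx (@derivable_id R 'rV[R]_n x v).
by rewrite derive_id => /rowP/(_ i); rewrite mxE.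
Qed.

Section ImplicitFunction.
Context {R : realType} {l d m : nat}.
Variables (P : 'rV[R]_(d + m) -> 'rV[R]_d) (x0 : 'rV[R]_d).
Variables (D0 : set 'rV[R]_l) (w0 : 'rV[R]_l) (Y : 'rV[R]_l -> 'rV[R]_m).
Hypothesis polyP : forall j, polyfun (fun z => P z 0 j).
Hypotheses (oD0 : open D0) (D0w0 : D0 w0) (smoothY : smooth_on D0 Y).
Let z0 := row_mx x0 (Y w0).
Hypothesis P0 : P z0 = 0.
Let J := \matrix_(i < d, j < d)
  'D_(delta_mx 0 (lshift m i)) (fun z => P z 0 j) z0.
Hypothesis J_unit : J \in unitmx.

(** Hadamard's lemma for all components of P at once, the differences in x and in
the parameters y being kept apart.  On the diagonal the coefficient of the
difference in x is the partial derivative. *)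
Lemma polyfun_difference_matrices :
  exists (Q1 : 'rV[R]_(d + m + (d + m)) -> 'M[R]_d)
         (Q2 : 'rV[R]_(d + m + (d + m)) -> 'M[R]_(m, d)),
  [/\ forall i j, polyfun (fun z => Q1 z i j),
      forall i j, polyfun (fun z => Q2 z i j),
      forall x' y' x y (z := row_mx (row_mx x' y') (row_mx x y)),
        P (row_mx x' y') - P (row_mx x y) = (x' - x) *m Q1 z + (y' - y) *m Q2 z &
      Q1 (row_mx z0 z0) = J].
Proof.
have /choice[Q HQ] := fun j => polyfun_hadamard (polyP j).
exists (fun z => \matrix_(i, j) Q j (lshift m i) z),
       (fun z => \matrix_(i, j) Q j (rshift d i) z); split.
- by move=> i j; under eq_fun do rewrite mxE; exact: (HQ j).1.
- by move=> i j; under eq_fun do rewrite mxE; exact: (HQ j).1.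
- move=> x' y' x y z; apply/rowP => j.
  rewrite !mxE (HQ j).2 big_split_ord /=; congr (_ + _).
    by apply: eq_bigr => i _; rewrite !row_mxEl !mxE.
  by apply: eq_bigr => i _; rewrite !row_mxEr !mxE.
apply/matrixP => i j; rewrite !mxE.
have [pQ eQ] := HQ j.
have [|||_ ->] := @product_difference _ _ _ (fun z => P z 0 j)
  (fun k (z : 'rV[R]_(d + m)) => z 0 k) (fun k z => Q j k (row_mx z z0)) z0.
- by move=> k; exact: differentiable_coord.
- move=> k; apply: (falg_polyfun (continuous_algebra _) (pQ k)) => r.
  apply: (falg_row_mx (S := fun f => {for z0, continuous f})
                      (x := id) (y := fun=> z0)) => s.
    exact: coord_continuous.
  exact: (falg_cst (continuous_algebra _)).
- by near=> z; exact: eQ.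
rewrite (bigD1 (lshift m i)) //= big1 ?addr0 => [|k kE].
  by rewrite derive_coordinate mxE !eqxx mul1r.
by rewrite derive_coordinate mxE (negbTE kE) andbF mul0r.
Unshelve. all: by end_near. Qed.


(** Uniqueness is stated on a ball that does not depend on w, since it serves to
recognise a solution known beforehand. *)
Theorem implicit_polynomial_function :
  exists (D : set 'rV[R]_l) (r : R) (X : 'rV[R]_l -> 'rV[R]_d),
  [/\ open D, D w0, D `<=` D0, 0 < r & smooth_on D X] /\
  [/\ X w0 = x0,
      forall w, D w -> P (row_mx (X w) (Y w)) = 0 &
      forall w x, D w -> `|x - x0| <= r -> P (row_mx x (Y w)) = 0 -> x = X w].
Proof.
have [Q1 [Q2 [pQ1 pQ2 PQ Q1J]]] := polyfun_difference_matrices.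
pose A := invmx J.
have AK : Q1 (row_mx z0 z0) *m A = 1%:M by rewrite Q1J mulmxV.
(* As d e <= 1/2, multiplication by a matrix with entries at most e at least
   halves norms. *)
pose e : R := (2 * d.+1%:R)^-1.
have e0 : 0 < e by rewrite invr_gt0 mulr_gt0.
have [rho rho0 Hrho] : exists2 rho : R, 0 < rho & forall z' z : 'rV[R]_(d + m),
    `|z' - z0| <= rho -> `|z - z0| <= rho ->
    forall i j, `|(1%:M - Q1 (row_mx z' z) *m A) i j| <= e.
  have near_e i j : \forall z \near row_mx z0 z0,
      `|(1%:M - Q1 z *m A) i j| <= e.
    have pK : polyfun (fun z => (1%:M - Q1 z *m A) i j).
      under eq_fun do rewrite !mxE.
      apply: (falgB (polyfun_algebra _)); first exact: polyfun_cst.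
      apply: (falg_sum (polyfun_algebra _)) => k _.
      by apply: polyfunM => //; exact: polyfun_cst.
    have /cvgrPdist_le /(_ _ e0) := @polyfun_continuous _ _ _ pK (row_mx z0 z0).
    by apply: filterS => z; rewrite AK subrr [X in X - _]mxE sub0r normrN.
  have : \forall z \near row_mx z0 z0, forall ij : 'I_d * 'I_d,
      `|(1%:M - Q1 z *m A) ij.1 ij.2| <= e.
    near=> z => ij; move: ij; near: z; apply: filter_forall => ij.
    exact: near_e.
  move=> /nbhs_ballP[r /= r0 rH]; exists (r / 2); first by rewrite divr_gt0.
  move=> z' z z'r zr i j; apply: (rH _ _ (i, j)); rewrite -ball_normE /=.
  rewrite opp_row_mx add_row_mx.
  apply: (@le_lt_trans _ _ (r / 2)); last by lra.
  by apply: row_mx_norm_le; rewrite distrC.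
have near_norm x y : `|x - x0| <= rho -> `|y - Y w0| <= rho ->
    `|row_mx x y - z0| <= rho.
  by move=> xr yr; rewrite /z0 opp_row_mx add_row_mx; exact: row_mx_norm_le.

have key x' x y' y : `|x' - x0| <= rho -> `|x - x0| <= rho ->
    `|y' - Y w0| <= rho -> `|y - Y w0| <= rho ->
    forall v : 'rV[R]_d, `|v - v *m Q1 (row_mx (row_mx x' y') (row_mx x y)) *m A|
              <= 2^-1 * `|v|.
  move=> x'r xr y'r yr v.
  have H := Hrho _ _ (near_norm _ _ x'r y'r) (near_norm _ _ xr yr).
  have -> : v - v *m Q1 (row_mx (row_mx x' y') (row_mx x y)) *m A =
      v *m (1%:M - Q1 (row_mx (row_mx x' y') (row_mx x y)) *m A).
    by rewrite mulmxBr mulmx1 mulmxA.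
  apply: (@le_trans _ _ (d%:R * e * `|v|)).
    exact: (mulmx_norm_le v (ltW e0) H).
  apply: ler_wpM2r => //.
  rewrite /e invfM mulrCA ler_piMr ?invr_ge0 // ler_pdivrMr ?ltr0n // mul1r.
  by rewrite ler_nat.
have contr x' x y : `|x' - x0| <= rho -> `|x - x0| <= rho ->
    `|y - Y w0| <= rho ->
    `|(x' - x) - (P (row_mx x' y) - P (row_mx x y)) *m A| <= 2^-1 * `|x' - x|.
  move=> x'r xr yr; rewrite PQ subrr mul0mx addr0; exact: key.
have [D [oD Dw0 DD0 DY]] : exists D : set 'rV[R]_l,
    [/\ open D, D w0, D `<=` D0 & forall w, D w ->
      `|Y w - Y w0| <= rho /\ `|P (row_mx x0 (Y w)) *m A| <= rho / 2].
  have cY : {for w0, continuous Y} by exact: (smoothY 0%N).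
  pose G w := P (row_mx x0 (Y w)) *m A.
  have cG : {for w0, continuous G}.
    apply: (@cvg_row _ _ (nbhs w0)) => j; apply: (falg_mulmx (continuous_algebra w0)) => i k.
      rewrite ord1; apply: (falg_polyfun (continuous_algebra w0) (polyP k)) => s.
      apply: (falg_row_mx (S := fun f => {for w0, continuous f})
                          (x := fun=> x0) (y := Y)) => t.
        exact: (falg_cst (continuous_algebra _)).
      apply: (@continuous_comp _ _ _ Y (fun M : 'rV[R]_m => M 0 t)) => //.
      exact: coord_continuous.
    exact: (falg_cst (continuous_algebra _)).
  have G0 : G w0 = 0 by rewrite /G -/z0 P0 mul0mx.
  have rho2 : 0 < rho / 2 by rewrite divr_gt0.
  pose E w := D0 w /\ `|Y w - Y w0| <= rho /\ `|G w| <= rho / 2.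
  exists (interior E); split.
  - exact: open_interior.
  - have /cvgrPdist_le /(_ _ rho0) HY := cY.
    have /cvgrPdist_le /(_ _ rho2) HG := cG.
    near=> w; split; first by near: w; exact: (open_near oD0 D0w0).
    split; first by rewrite distrC; near: w; exact: HY.
    by rewrite -normrN -[- _]add0r -G0; near: w; exact: HG.
  - by move=> w /interior_subset [].
  - by move=> w /interior_subset [].

have AU : A \in unitmx by rewrite unitmx_inv.
(* T is Newton's iteration with the derivative frozen at the base point. *)
have solve w : exists x, D w ->
    `|x - x0| <= rho /\ P (row_mx x (Y w)) = 0.
  have [Dw|nDw] := pselect (D w); last by exists x0.
  have [Yw Pw] := DY w Dw.
  pose B := [set x : 'rV[R]_d | `|x - x0| <= rho].
  pose T x := x - P (row_mx x (Y w)) *m A.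
  have TB : set_fun B B T.
    move=> x xB; have xr : `|x - x0| <= rho by [].
    rewrite /B /T /=.
    have x0r : `|x0 - x0| <= rho by rewrite subrr normr0 ltW.
    have := contr x x0 (Y w) xr x0r Yw.
    have -> : x - P (row_mx x (Y w)) *m A - x0 =
      (x - x0 - (P (row_mx x (Y w)) - P (row_mx x0 (Y w))) *m A)
        - P (row_mx x0 (Y w)) *m A.
      by rewrite mulmxBl opprB !addrA; apply/rowP => j; rewrite !mxE; ring.
    move=> h; apply: le_trans (ler_normB _ _) _.
    by apply: (le_trans (lerD h Pw)); move: xr; lra.
  have [] := @banach_fixed_point _ _ B (mkfun TB).
  - exists (2^-1)%:nng; split => /=; first lra.
    move=> [x' x] /= [x'B xB]; rewrite /T.
    have x'r : `|x' - x0| <= rho by [].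
    have xr : `|x - x0| <= rho by [].
    have := contr x' x (Y w) x'r xr Yw; congr (_ <= _); congr (`|_|).
    by rewrite mulmxBl; apply/rowP => j; rewrite !mxE; ring.
  - have -> : B = closed_ball_ Num.norm x0 rho.
      by apply/seteqP; split=> x; rewrite /B /closed_ball_ /= distrC.
    exact: closed_closed_ball_.
  - by exists x0; rewrite /B /= subrr normr0 ltW.
  move=> x xB /= fx; have xr : `|x - x0| <= rho by [].
  have Tx : x = T x by [].
  exists x => _; split=> //.
  have /(congr1 (mulmx^~ J)) : P (row_mx x (Y w)) *m A = 0.
    by apply/eqP; rewrite -oppr_eq0 -(inj_eq (addrI x)) addr0 -/(T x) -Tx.
  by rewrite /= -mulmxA mulVmx // mulmx1 mul0mx.
have [X HX] := choice solve.
have uniq w x : D w -> `|x - x0| <= rho -> P (row_mx x (Y w)) = 0 -> x = X w.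
  move=> Dw xr Px; have [Xr PX] := HX w Dw; have [Yw _] := DY w Dw.
  have := contr x (X w) (Y w) xr Xr Yw; rewrite Px PX subrr mul0mx subr0.
  move=> h; apply/eqP; rewrite -subr_eq0 -normr_le0.
  by move: h (normr_ge0 (x - X w)); lra.
exists D, rho, X; split; last first.
  split=> // [|w /HX[]//]; apply/esym; apply: uniq => //.
  by rewrite subrr normr0 ltW.
split=> //.
pose z w := row_mx (X w) (Y w).
pose M w' w := Q1 (row_mx (z w') (z w)).
have MU w' w : D w' -> D w -> M w' w \in unitmx.
  move=> Dw' Dw; apply: (contraction_unitmx (A := A)).
  have [[? _] [? _]] := (HX w Dw, HX w' Dw').
  by have [[? _] [? _]] := (DY w Dw, DY w' Dw'); exact: key.
(* By Cramer's rule N is - Q2 times the inverse of Q1, in a form that is smooth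
   wherever the determinant is. *)
pose N w' w := - (\det (M w' w))^-1 *: (Q2 (row_mx (z w') (z w)) *m \adj (M w' w)).
have XN w' w : D w' -> D w -> X w' - X w = (Y w' - Y w) *m N w' w.
  move=> Dw' Dw; have := PQ (X w') (Y w') (X w) (Y w).
  rewrite (HX w' Dw').2 (HX w Dw).2 subrr /= -/(z w') -/(z w) -/(M w' w).
  move/(congr1 (mulmx^~ (\adj (M w' w)))); rewrite mul0mx mulmxDl -!mulmxA.
  have dU : \det (M w' w) != 0 by rewrite -unitfE -unitmxE MU.
  rewrite mul_mx_adj mul_mx_scalar => /eqP; rewrite eq_sym addr_eq0 => /eqP E.
  by rewrite /N -scalemxAr scaleNr -scalerN -E scalerA mulVf // scale1r.
have Xcont w : D w -> {for w, continuous X}.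
  move=> Dw; pose G w' := P (row_mx (X w) (Y w')) *m A.
  have cG : {for w, continuous G}.
    apply: (@cvg_row _ _ (nbhs w)) => j.
    apply: (falg_mulmx (continuous_algebra w)) => i k.
      rewrite ord1; apply: (falg_polyfun (continuous_algebra w) (polyP k)) => s.
      apply: (falg_row_mx (S := fun f => {for w, continuous f})
                          (x := fun=> X w) (y := Y)) => t.
        exact: (falg_cst (continuous_algebra _)).
      apply: (@continuous_comp _ _ _ Y (fun M : 'rV[R]_m => M 0 t)) => //.
        by apply: (smoothY 0%N); exact: DD0.
      exact: coord_continuous.
    exact: (falg_cst (continuous_algebra _)).
  have G0 : G w = 0 by rewrite /G (HX w Dw).2 mul0mx.
  apply/(@cvgrPdist_le _ _ _ (nbhs w)) => e1 e10.
  have e12 : 0 < e1 / 2 by rewrite divr_gt0.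
  have /cvgrPdist_le /(_ _ e12) := cG; rewrite G0 => HG.
  apply: filterS2 (open_near oD Dw) HG => w' Dw'; rewrite sub0r normrN => Gw'.
  have := contr (X w') (X w) (Y w') (HX w' Dw').1 (HX w Dw).1 (DY w' Dw').1.
  rewrite (HX w' Dw').2 sub0r mulNmx opprK -/(G w') => h.
  have : `|X w' - X w| <= `|X w' - X w + G w'| + `|G w'|.
    by rewrite -{1}[X w' - X w](addrK (G w')) ler_normB.
  by rewrite (distrC (X w)); move: h Gw'; lra.
have zalg (S : ('rV[R]_l -> R) -> Prop) : function_algebra S ->
    (forall i, S (fun w => X w 0 i)) -> (forall i, S (fun w => Y w 0 i)) ->
    forall i, S (fun w => z w 0 i).
  by move=> HS SX SY i; exact: falg_row_mx.

have Nalg (S : ('rV[R]_l -> R) -> Prop) (a b : 'rV[R]_l -> 'rV[R]_(d + m))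
    (HS : function_algebra S)
    (Sa : forall i, S (fun w => a w 0 i)) (Sb : forall i, S (fun w => b w 0 i)) :
  S (fun w => (\det (Q1 (row_mx (a w) (b w))))^-1) ->
  forall i j, S (fun w => (- (\det (Q1 (row_mx (a w) (b w))))^-1 *:
    (Q2 (row_mx (a w) (b w)) *m \adj (Q1 (row_mx (a w) (b w))))) i j).
  move=> Sdet i j; under eq_fun do rewrite mxE.
  have Sab k : S (fun w => (row_mx (a w) (b w)) 0 k) by exact: falg_row_mx.
  apply: (falgM HS); first exact: (falgN HS).
  apply: (falg_mulmx HS) => i' j'.
    exact: (falg_polyfun HS (pQ2 i' j') Sab).
  apply: (falg_adj HS) => i2 j2; exact: (falg_polyfun HS (pQ1 i2 j2) Sab).
have detalg (S : ('rV[R]_l -> R) -> Prop) (a b : 'rV[R]_l -> 'rV[R]_(d + m))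
    (HS : function_algebra S)
    (Sa : forall i, S (fun w => a w 0 i)) (Sb : forall i, S (fun w => b w 0 i)) :
  S (fun w => \det (Q1 (row_mx (a w) (b w)))).
  apply: (falg_det HS) => i j.
  by apply: (falg_polyfun HS (pQ1 i j)) => k; exact: falg_row_mx.
have det0 w' w : D w' -> D w -> \det (M w' w) != 0.
  by move=> Dw' Dw; rewrite -unitfE -unitmxE MU.
have Ncont w : D w -> forall i j, {for w, continuous (fun w' => N w' w i j)}.
  move=> Dw; have HS := @continuous_algebra R _ w.
  have Sz k : {for w, continuous (fun w => z w 0 k)}.
    apply: (zalg _ HS) => i.
      apply: (@continuous_comp _ _ _ X (fun M : 'rV[R]_d => M 0 i)).
        exact: Xcont.
      exact: coord_continuous.
    apply: (@continuous_comp _ _ _ Y (fun M : 'rV[R]_m => M 0 i)).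
      by apply: (smoothY 0%N); exact: DD0.
    exact: coord_continuous.
  have Sw k : {for w, continuous (fun=> z w 0 k : R)} by exact: (falg_cst HS).
  apply: (Nalg _ z (fun=> z w) HS Sz Sw).
  exact: (cvgV (det0 w w Dw Dw) (detalg _ z (fun=> z w) HS Sz Sw)).
have Ydiff w i : D w -> differentiable (fun w => Y w 0 i) w.
  move=> Dw; apply: differentiable_coord_comp.
  by have [+ _] := smoothY 1%N; apply; exact: DD0.
have XD w j : D w -> differentiable (fun w => X w 0 j) w /\
    forall v, 'D_v (fun w => X w 0 j) w = \sum_i 'D_v (fun w => Y w 0 i) w * N w w i j.
  move=> Dw; apply: (@product_difference _ _ _ (fun w => X w 0 j)
    (fun i w => Y w 0 i) (fun i w' => N w' w i j)).
  - by move=> i; exact: Ydiff.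
  - by move=> i; exact: Ncont.
  - apply: filterS (open_near oD Dw) => w' Dw'.
    have := XN w' w Dw' Dw => /rowP/(_ j); rewrite !mxE => ->.
    by apply: eq_bigr => i _; rewrite !mxE.
(* The derivative of X is a rational expression in X, Y and the derivative of Y:
   if X is C^k then so is its derivative. *)
elim=> [|k IH]; first exact: Xcont.
have dX w : D w -> differentiable X w.
  by move=> Dw; apply: differentiable_row => j; have [] := XD w j Dw.
split=> // v; apply/(C_on_row oD) => j.
have HS := C_on_algebra oD k.
apply: (C_on_eq oD (f := fun w => \sum_i ('D_v Y w) 0 i * N w w i j)).
  move=> w Dw; rewrite derive_coord; last exact: dX.
  rewrite (XD w j Dw).2; apply: eq_bigr => i _; rewrite derive_coord //.
  by have [+ _] := smoothY 1%N; apply; exact: DD0.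
have CY : C_on k D Y by exact: C_on_sub DD0 (smoothY k).
have Sz i : C_on k D (fun w => z w 0 i).
  by apply: (zalg _ HS) => i'; [exact: (C_on_row oD _ _).2|exact: (C_on_row oD _ _).2].
apply: (falg_sum HS) => i _; apply: (falgM HS).
  apply: (C_on_row oD _ _).2; apply: C_on_sub DD0 _.
  by have [_] := smoothY k.+1; exact.
apply: (Nalg _ z z HS Sz Sz); apply: (C_onV oD); last exact: (detalg _ z z HS).
by move=> w Dw; exact: (det0 w w Dw Dw).
Unshelve. all: by end_near. Qed.

End ImplicitFunction.

(** * Local diffeomorphisms *)

Section InverseFunction.
Context {R : realType} {n : nat}.

Lemma jacobian_entry m (f : 'rV[R]_n -> 'rV[R]_m) w i j :
  differentiable f w -> jacobian f w i j = ('D_(delta_mx 0 i) f w) 0 j.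
Proof. by move=> df; rewrite deriveEjacobian // -rowE [RHS]mxE. Qed.

Lemma mean_value_line (f : 'rV[R]_n -> R) w h :
  (forall t : R, 0 <= t <= 1 -> differentiable f (t *: h + w)) ->
  exists2 t : R, 0 <= t <= 1 & f (h + w) - f w = 'D_h f (t *: h + w).
Proof.
move=> df; pose phi (t : R) := f (t *: h + w).
have phi' (t : R) : 0 <= t <= 1 -> is_derive t (1 : R) phi ('D_h f (t *: h + w)).
  move=> t01; have dv : derivable f (t *: h + w) h by apply: diff_derivable; exact: df.
  have E : (fun s : R => s^-1 *: (phi (s *: 1 + t) - phi t)) =
      fun s => s^-1 *: (f (s *: h + (t *: h + w)) - f (t *: h + w)).
    apply/funext => s; have -> : s *: (1 : R) = s by exact: mulr1.
    by rewrite /phi scalerDl addrA.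
  by apply: DeriveDef; rewrite ?/derivable /derive /= E.
have cphi : {within `[0, 1], continuous phi}.
  apply: continuous_in_subspaceT => t; rewrite inE /= in_itv /= => /phi' [dphi _].
  by apply: differentiable_continuous; apply/derivable1_diffP.
have dphi (t : R) : t \in `]0, 1[ -> is_derive t (1 : R) phi ('D_h f (t *: h + w)).
  by rewrite in_itv /= => /andP[t0 t1]; apply: phi'; rewrite !ltW.
have [t t01 E] := MVT_segment ler01 dphi cphi.
exists t; first by move: t01; rewrite in_itv.
by move: E; rewrite /phi subr0 mulr1 scale1r scale0r add0r.
Qed.

(** By the mean value theorem applied to each component, f(w') - f(w) is w' - w
times a matrix whose j-th column is the gradient of f_j at some point of the
segment.  Near w0 such a matrix is close to the jacobian at w0, hence
invertible, so f is injective. *)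
Theorem local_diffeomorphism (f : 'rV[R]_n -> 'rV[R]_n) D w0 :
  open D -> D w0 -> C_on 1 D f -> jacobian f w0 \in unitmx ->
  exists E, [/\ open E, E w0, E `<=` D, set_inj E f &
                forall w, E w -> jacobian f w \in unitmx].
Proof.
move=> oD Dw0 [df Df] JU; pose A := invmx (jacobian f w0).
pose g i j w := ('D_(delta_mx 0 i) f w) 0 j.
have cg i j : {for w0, continuous (g i j)}.
  exact: (C_on_row oD 0 _).2 (Df (delta_mx 0 i)) j w0 Dw0.
have gE w i j : D w -> jacobian f w i j = g i j w.
  by move=> Dw; rewrite jacobian_entry //; exact: df.
pose e : R := (2 * (n%:R * `|A| * n%:R + 1))^-1.
have c0 : 0 <= n%:R * `|A| * n%:R by rewrite !mulr_ge0.
have e0 : 0 < e by rewrite invr_gt0; lra.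
have [r r0 rH] : exists2 r : R, 0 < r & forall w, ball w0 r w ->
    D w /\ forall i j, `|g i j w0 - g i j w| <= e.
  have : \forall w \near w0, D w /\ forall ij, `|g ij.1 ij.2 w0 - g ij.1 ij.2 w| <= e.
    near=> w; split; first by near: w; exact: (open_near oD Dw0).
    move=> ij; move: ij; near: w; apply: filter_forall => ij.
    by have /cvgrPdist_le /(_ _ e0) := cg ij.1 ij.2.
  move=> /nbhs_ballP[r r0 rH]; exists r => // w /rH [Dw H]; split=> // i j.
  exact: (H (i, j)).
(* Stated for all matrices close to the jacobian, as the columns may be gradients
   at different points. *)
have closeU (M : 'M[R]_n) : (forall i j, `|g i j w0 - M i j| <= e) -> M \in unitmx.
  move=> H; apply: (contraction_unitmx (A := A)) => x.
  have -> : x - x *m M *m A = x *m (jacobian f w0 - M) *m A.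
    by rewrite mulmxBr mulmxBl -!mulmxA mulmxV // mulmx1.
  have HA := mulmx_norm_le (x *m (jacobian f w0 - M)) (normr_ge0 A) (mx_entry_le A).
  have HM : `|x *m (jacobian f w0 - M)| <= n%:R * e * `|x|.
    apply: mulmx_norm_le; first exact: ltW.
    by move=> i j; rewrite mxE [X in _ + X]mxE gE.
  apply: (le_trans HA); apply: (@le_trans _ _ (n%:R * `|A| * (n%:R * e * `|x|))).
    by rewrite ler_wpM2l // mulr_ge0.
  have -> : n%:R * `|A| * (n%:R * e * `|x|) = n%:R * `|A| * n%:R * e * `|x|.
    by ring.
  rewrite ler_wpM2r // /e ler_pdivrMr; lra.
have ballD w : ball w0 r w -> D w by case/rH.
exists (ball w0 r); split.
- exact: ball_open.
- exact: ballxx.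
- exact: ballD.
- move=> w w'; rewrite !inE => Ew Ew' fww'.
  pose h := w' - w.
  have seg (t : R) : 0 <= t <= 1 -> ball w0 r (t *: h + w).
    move=> /andP[t0 t1]; move: Ew Ew'; rewrite -ball_normE /= => Ew Ew'.
    have -> : w0 - (t *: h + w) = (1 - t) *: (w0 - w) + t *: (w0 - w').
      by rewrite /h; apply/rowP => j; rewrite !mxE; ring.
    apply: le_lt_trans (ler_normD _ _) _; rewrite !normrZ ger0_norm ?subr_ge0 //.
    rewrite (ger0_norm t0).
    have -> : r = (1 - t) * r + t * r by ring.
    have [t0'|t0'] := eqVneq t 0.
      by rewrite t0' !mul0r !addr0 subr0 !mul1r.
    apply: ler_ltD; first by rewrite ler_wpM2l ?subr_ge0 // ltW.
    by rewrite ltr_pM2l // lt_neqAle eq_sym t0' t0.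
  have mv j : exists xi, ball w0 r xi /\ f w' 0 j - f w 0 j = \sum_i h 0 i * g i j xi.
    have [t t01 E] := @mean_value_line (fun w => f w 0 j) w h
      (fun t t01 => differentiable_coord_comp j (df _ (ballD _ (seg t t01)))).
    exists (t *: h + w); split; first exact: seg.
    have dt := df _ (ballD _ (seg t t01)).
    move: E; rewrite /h subrK -/h => ->.
    rewrite -derive_coord // deriveEjacobian // mxE; apply: eq_bigr => i _.
    by rewrite jacobian_entry.
  have [xi Hxi] := choice mv.
  pose M : 'M[R]_n := \matrix_(i, j) g i j (xi j).
  have MU : M \in unitmx.
    by apply: closeU => i j; rewrite mxE; exact: (rH _ (Hxi j).1).2.
  have hM : h *m M = 0.
    apply/rowP => j; rewrite [RHS]mxE [LHS]mxE; have := (Hxi j).2; rewrite fww' subrr.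
    move=> E; apply: etrans (esym E).
    by apply: eq_bigr => i _; rewrite [M i j]mxE.
  have : h = 0 by rewrite -[h]mulmx1 -(mulmxV MU) mulmxA hM mul0mx.
  by move=> /eqP; rewrite subr_eq0 => /eqP.
- move=> w Ew; apply: closeU => i j; rewrite gE; last exact: ballD.
  exact: (rH _ Ew).2.
Unshelve. all: by end_near. Qed.

End InverseFunction.

(** * Terms of order two *)

Lemma sum_closed (R : realType) (T : Type) (S : (T -> R) -> Prop)
    (I : eqType) (r : seq I) (F : I -> T -> R) :
  S (fun=> 0) -> (forall f g, S f -> S g -> S (fun t => f t + g t)) ->
  (forall i, i \in r -> S (F i)) -> S (fun t => \sum_(i <- r) F i t).
Proof.
move=> S0 SD; elim: r => [|i r IH] SF.
  by under eq_fun do rewrite big_nil.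
under eq_fun do rewrite big_cons.
apply: SD; first by apply: SF; rewrite mem_head.
by apply: IH => j jr; apply: SF; rewrite in_cons jr orbT.
Qed.

Section Monomials.

Lemma mnm_split n (m : mpoly.multinom n) : (0 < mpoly.mdeg m)%N ->
  exists i m', m = mpoly.mnm_add (mpoly.mnm1 i) m'.
Proof.
move=> m_gt0; have [i mi] : exists i, (0 < m i)%N.
  apply/existsP; apply: contraTT m_gt0 => /existsPn H.
  rewrite -leqNgt leqn0 mpoly.mdegE big1 // => i _; apply/eqP.
  by rewrite -leqn0 leqNgt.
exists i, (mpoly.mnm_sub m (mpoly.mnm1 i)).
apply/mpoly.mnmP => j; rewrite mpoly.mnmDE mpoly.mnmBE mpoly.mnm1E.
by case: eqP => [<-|_]; lia.
Qed.

Lemma mnm_split2 n (m : mpoly.multinom n) : (2 <= mpoly.mdeg m)%N ->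
  exists i j m',
    m = mpoly.mnm_add (mpoly.mnm1 i) (mpoly.mnm_add (mpoly.mnm1 j) m').
Proof.
move=> m2; have [|i [m' mE]] := @mnm_split _ m; first by lia.
have [|j [m'' mE']] := @mnm_split _ m'.
  by move: m2; rewrite mE mpoly.mdegD mpoly.mdeg1; lia.
by exists i, j, m''; rewrite -mE'.
Qed.

Lemma mmap1D (R : comNzRingType) n (t : 'I_n -> R) m m' :
  mpoly.mmap1 t (mpoly.mnm_add m m') = mpoly.mmap1 t m * mpoly.mmap1 t m'.
Proof. by apply: mpoly.commr_mmap1_M => i x; rewrite /GRing.comm mulrC. Qed.

Lemma mmap1Z (R : comNzRingType) n (a : R) (t : 'I_n -> R) m :
  mpoly.mmap1 (fun i => a * t i) m = a ^+ mpoly.mdeg m * mpoly.mmap1 t m.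
Proof.
rewrite /mpoly.mmap1 mpoly.mdegE -prodrXr -big_split.
by apply: eq_bigr => i _; rewrite exprMn.
Qed.

Lemma falg_mmap1 (R : realType) (T : Type) (S : (T -> R) -> Prop) n
    (t : T -> 'I_n -> R) m :
  function_algebra S -> (forall i, S (fun x => t x i)) ->
  S (fun x => mpoly.mmap1 (t x) m).
Proof.
by move=> HS St; apply: (falg_prod HS) => i _; exact: (falgX HS).
Qed.

End Monomials.

Section OrderTwo.
Context {R : realType}.

Lemma homogeneous_order_ge n m k (f : mpoly.mpoly m (mpoly.mpoly n R)) :
  homogeneous k f -> order_ge k f.
Proof. by move=> /allP hf mon /hf /= /eqP ->. Qed.

Lemma ev2_order_ge1 n m (x : 'rV[R]_n) (f : mpoly.mpoly m (mpoly.mpoly n R)) :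
  order_ge 1 f -> ev2 x 0 f = 0.
Proof.
move=> f1; rewrite /ev2 /mpoly.mmap big_seq big1 // => mon /f1 /mnm_split.
by move=> [i [m' ->]]; rewrite mmap1D mpoly.mmap1U mxE mul0r mulr0.
Qed.

(** Every monomial has the form t_i t_j r: its increment is the increment of t_i
times t_j r, and t_j vanishes at w0. *)
Lemma derive_order2 (V : normedModType R) n m (x : V -> 'rV[R]_n)
    (t : V -> 'rV[R]_m) (f : mpoly.mpoly m (mpoly.mpoly n R)) w0 :
  order_ge 2 f -> (forall i, {for w0, continuous (fun w => x w 0 i)}) ->
  (forall i, differentiable (fun w => t w 0 i) w0) -> t w0 = 0 ->
  differentiable (fun w => ev2 (x w) (t w) f) w0 /\
  forall v, 'D_v (fun w => ev2 (x w) (t w) f) w0 = 0.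
Proof.
move=> f2 cx dt t0; rewrite /ev2 /mpoly.mmap.
have HS := @continuous_algebra R _ w0.
apply: (@sum_closed _ _ (fun F : V -> R => differentiable F w0 /\
    forall v, 'D_v F w0 = 0)).
- by split=> [|v]; [exact: differentiable_cst|exact: derive_cst].
- move=> F G [dF F0] [dG G0]; split=> [|v]; first exact: differentiableD.
  by rewrite deriveD ?F0 ?G0 ?addr0 //; exact: diff_derivable.
move=> mon /f2 /mnm_split2 [i [j [m' monE]]].
pose rest w := t w 0 j * (ev (x w) (mpoly.mcoeff mon f) * mpoly.mmap1 (t w 0) m').
have crest : {for w0, continuous rest}.
  have ct k : {for w0, continuous (fun w => t w 0 k)}.
    by apply: differentiable_continuous; exact: dt.
  have c1 := falg_ev HS (mpoly.mcoeff mon f) cx.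
  have c2 := falg_mmap1 (t := fun w => t w 0) m' HS ct.
  exact: (falgM HS (ct j) (falgM HS c1 c2)).
have rest0 : rest w0 = 0 by rewrite /rest t0 mxE mul0r.
have -> : (fun w => ev (x w) (mpoly.mcoeff mon f) *
    mpoly.mmap1 (t w 0) mon) =
    fun w => t w 0 i * rest w.
  by apply/funext => w; rewrite [X in mpoly.mmap1 _ X]monE !mmap1D !mpoly.mmap1U /rest; ring.
have [|||dF DF] := @product_difference R V 1
  (fun w => t w 0 i * rest w) (fun _ w => t w 0 i) (fun _ => rest) w0.
- by move=> _; exact: dt.
- by move=> _; exact: crest.
- near=> w; rewrite big_ord_recl big_ord0 addr0 rest0 t0 mulr0 subr0.
  by rewrite [X in _ - X]mxE subr0.
split=> // v; rewrite DF big_ord_recl big_ord0 addr0 rest0 mulr0 //.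
Unshelve. all: by end_near. Qed.

Lemma polyfun_mpoly n (g : 'rV[R]_n -> R) : polyfun g ->
  exists A : mpoly.mpoly n R, forall x, ev x A = g x.
Proof.
elim=> [c|i|f h _ [A eA] _ [B eB]|f h _ [A eA] _ [B eB]].
- by exists (mpoly.mpolyC n c) => x; exact: mpoly.mevalC.
- by exists (mpoly.mpolyX R (mpoly.mnm1 i)) => x; exact: mpoly.mevalXU.
- by exists (A + B) => x; rewrite -eA -eB; exact: mpoly.mevalD.
- by exists (A * B) => x; rewrite -eA -eB; exact: mpoly.mevalM.
Qed.

(** The functions x |-> h(x, tau x) with h homogeneous of degree 2 in its second
argument.  Such an h is not determined by the function, since tau x may also
enter its coefficients; this freedom absorbs terms of degree greater than 2. *)
Definition quadratic_in n m (tau : 'rV[R]_n -> 'rV[R]_m) (F : 'rV[R]_n -> R) :=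
  exists h : mpoly.mpoly m (mpoly.mpoly n R),
    homogeneous 2 h /\ forall x, ev2 x (tau x) h = F x.

Lemma quadratic_in0 n m (tau : 'rV[R]_n -> 'rV[R]_m) :
  quadratic_in tau (fun=> 0).
Proof.
exists 0; split; first by apply/mpoly.dhomogP => k; rewrite mpoly.msupp0.
by move=> x; rewrite /ev2 /mpoly.mmap mpoly.msupp0 big_nil.
Qed.

Lemma quadratic_inD n m (tau : 'rV[R]_n -> 'rV[R]_m) F G :
  quadratic_in tau F -> quadratic_in tau G ->
  quadratic_in tau (fun x => F x + G x).
Proof.
move=> [h [h2 hF]] [k [k2 kG]]; exists (h + k); split; first exact: rpredD.
move=> x; rewrite -hF -kG; exact: (mpoly.mmapD _ (mpoly.meval (x 0))).
Qed.

Lemma quadratic_inM n m (tau : 'rV[R]_n -> 'rV[R]_m) a i j :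
  polyfun a -> quadratic_in tau (fun x => a x * (tau x 0 i * tau x 0 j)).
Proof.
move=> /polyfun_mpoly[A eA].
exists (A *: mpoly.mpolyX _ (mpoly.mnm_add (mpoly.mnm1 i) (mpoly.mnm1 j))).
split.
  apply: rpredZ; rewrite mpoly.dhomogX /=.
  by rewrite mpoly.mdegD !mpoly.mdeg1.
move=> x; rewrite /ev2 -eA.
rewrite (mpoly.mmapZ _ (mpoly.meval (x 0))) (mpoly.mmapX _ (mpoly.meval (x 0))).
by rewrite mmap1D !mpoly.mmap1U.
Qed.

Lemma quadratic_in_sum n m (tau : 'rV[R]_n -> 'rV[R]_m) (I : eqType)
    (r : seq I) (F : I -> 'rV[R]_n -> R) :
  (forall i, i \in r -> quadratic_in tau (F i)) ->
  quadratic_in tau (fun x => \sum_(i <- r) F i x).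
Proof. exact: sum_closed (quadratic_in0 tau) (@quadratic_inD _ _ tau). Qed.

(** Two of the linear forms in each monomial supply the quadratic factor; the
others are put into the coefficients. *)
Lemma quadratic_in_order2 n d q (tau : 'rV[R]_n -> 'rV[R]_d)
    (B : 'rV[R]_n -> 'M[R]_(d, q)) (a : mpoly.multinom q -> 'rV[R]_n -> R)
    (s : seq (mpoly.multinom q)) :
  (forall i, polyfun (fun x => tau x 0 i)) ->
  (forall i j, polyfun (fun x => B x i j)) ->
  (forall m, m \in s -> polyfun (a m)) ->
  (forall m, m \in s -> (2 <= mpoly.mdeg m)%N) ->
  quadratic_in tau
    (fun x => \sum_(m <- s) a m x * mpoly.mmap1 ((tau x *m B x) 0) m).
Proof.
move=> ptau pB pa s2; have HS := @polyfun_algebra R n.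
apply: quadratic_in_sum => m ms; have [k [l [m' mE]]] := mnm_split2 (s2 m ms).
have -> : (fun x => a m x * mpoly.mmap1 ((tau x *m B x) 0) m) =
   fun x => \sum_i \sum_j
     (a m x * mpoly.mmap1 ((tau x *m B x) 0) m' * B x i k * B x j l)
       * (tau x 0 i * tau x 0 j).
  apply/funext => x; rewrite mE !mmap1D !mpoly.mmap1U -mE.
  set c := mpoly.mmap1 _ m'; rewrite [in LHS]mxE [X in _ * (_ * (X * _))]mxE.
  rewrite mulrA mulr_sumr mulr_suml; apply: eq_bigr => i _.
  rewrite mulr_suml mulr_sumr; apply: eq_bigr => j _; ring.
apply: quadratic_in_sum => i _; apply: quadratic_in_sum => j _; apply: quadratic_inM.
apply: polyfunM => //; apply: polyfunM => //; apply: polyfunM; first exact: pa.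
apply: (falg_mmap1 (t := fun x => (tau x *m B x) 0) m' HS) => r.
by apply: (falg_mulmx HS) => // i' j'; rewrite ord1.
Qed.

End OrderTwo.

(** * Orthogonal complements *)

Section PositiveDefinite.
Context {R : realType} {d : nat}.
Implicit Types A G : 'M[R]_d.

Lemma posdef_unitmx A : posdef A -> A \in unitmx.
Proof.
move=> pA; rewrite -row_free_unit -kermx_eq0; apply/eqP/row_matrixP => i.
rewrite row0; apply/eqP/negPn/negP => /pA.
by rewrite -row_mul mulmx_ker row0 mul0mx mxE ltxx.
Qed.

(** With x = y A, the values of A^{-1} at x and of A at y agree. *)
Lemma posdef_invmx A : posdef A -> posdef (invmx A).
Proof.
move=> pA x x0; have Au := posdef_unitmx pA.
have [y yE] : exists y, y = x *m invmx A by eexists.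
have xE : x = y *m A by rewrite yE mulmxKV.
have y0 : y != 0 by apply: contraNneq x0 => y0; rewrite xE y0 mul0mx.
have := pA y y0.
have -> : x *m invmx A *m x^T = (y *m A *m y^T)^T.
  by rewrite -yE xE !trmx_mul trmxK.
by rewrite [X in _ -> 0 < X]mxE.
Qed.

Lemma posdef_gram_unitmx p G (J : 'M[R]_(p, d)) :
  posdef G -> row_free J -> J *m G *m J^T \in unitmx.
Proof.
move=> pG fJ; rewrite -row_free_unit -kermx_eq0; apply/eqP/row_matrixP => i.
rewrite row0; set x := row i _.
have xK : x *m (J *m G *m J^T) = 0 by rewrite /x -row_mul mulmx_ker row0.
apply/eqP; rewrite -(mulmx_free_eq0 _ fJ); apply/negPn/negP => /pG.
rewrite trmx_mul !mulmxA -(mulmxA x J G) -(mulmxA x) xK mul0mx mxE ltxx //.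
Qed.

End PositiveDefinite.

Section OrthogonalComplements.
Context {R : realType} {p q : nat}.
Local Notation d := (p + q)%N.

Lemma orthE_rank m (A : 'M[R]_(m, d)) : \rank (orthE A) = (d - \rank A)%N.
Proof. by rewrite /orthE mxrank_ker mxrank_tr. Qed.

Lemma orthEK m (A : 'M[R]_(m, d)) : (orthE (orthE A) :=: A)%MS.
Proof.
apply/eqmx_sym/eqmxP; rewrite -(geq_leqif (mxrank_leqif_eq _)).
  by rewrite !orthE_rank subKn ?rank_leq_col.
by apply/sub_kermxP; rewrite -[A in A *m _]trmxK -trmx_mul mulmx_ker trmx0.
Qed.

Lemma orthGE m (G : 'M[R]_d) (J : 'M[R]_(m, d)) : orthG G J = orthE (J *m G^T).
Proof. by rewrite /orthG /orthE trmx_mul trmxK. Qed.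

Lemma orth_orthGE m (G : 'M[R]_d) (J : 'M[R]_(m, d)) :
  (orthE (orthG G J) :=: J *m G^T)%MS.
Proof. by rewrite orthGE; exact: orthEK. Qed.

Section Cotangent.
Variables (G : 'M[R]_d) (J E : 'M[R]_(p, d)).
Hypotheses (pG : posdef G) (fJ : row_free J) (EJ : (E :=: orthE (orthG G J))%MS).

Lemma cotangent_factor : exists W : 'M[R]_p, J *m G^T = W *m E.
Proof. by apply/submxP; rewrite EJ orth_orthGE. Qed.

Lemma cotangent_orth (x : 'rV[R]_d) : x *m E^T = 0 -> x *m G *m J^T = 0.
Proof.
have [W WE] := cotangent_factor.
move=> xE; rewrite -mulmxA -[G *m J^T]trmxK trmx_mul trmxK WE trmx_mul mulmxA xE.
by rewrite mul0mx.
Qed.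

(** J G^T is a combination W E of the rows of E, and J G J^T = J E^T W^T is
invertible because G is positive definite. *)
Lemma cotangent_tangent_unitmx : J *m E^T \in unitmx.
Proof.
have [W WE] := cotangent_factor.
have := posdef_gram_unitmx pG fJ.
rewrite -mulmxA -[G *m J^T]trmxK trmx_mul trmxK WE trmx_mul mulmxA.
by rewrite unitmx_mul => /andP[].
Qed.

Lemma cotangent_free : row_free E.
Proof.
rewrite /row_free eqn_leq rank_leq_row /=; have := mxrankM_maxr J E^T.
by rewrite mxrank_tr mxrank_unit // cotangent_tangent_unitmx.
Qed.

End Cotangent.

Lemma row_free_complete (E : 'M[R]_(p, d)) : row_free E ->
  exists N : 'M[R]_(q, d), col_mx E N \in unitmx.
Proof.
move=> fE; exists (dsubmx (row_ebase E)).
have EE : E = col_ebase E *m usubmx (row_ebase E).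
  rewrite -{1}(mulmx_ebase E) (eqP fE) pid_mx_row.
  by rewrite -{1}(vsubmxK (row_ebase E)) -mulmxA mul_row_col mul1mx mul0mx addr0.
have -> : col_mx E (dsubmx (row_ebase E)) =
    block_mx (col_ebase E) 0 0 1%:M *m row_ebase E.
  rewrite -[in RHS](vsubmxK (row_ebase E)) mul_block_col !mul0mx mul1mx add0r addr0.
  by rewrite {1}EE.
rewrite unitmx_mul row_ebase_unit andbT unitmxE det_ublock det1 mulr1.
by rewrite -unitmxE col_ebase_unit.
Qed.

Lemma usubmx_free (A : 'M[R]_d) : A \in unitmx -> row_free (usubmx A).
Proof.
move=> AU; apply/row_freeP; exists (lsubmx (invmx A)).
rewrite mul_usub_mx mulmx_lsub mulmxV //; apply/matrixP => i j.
by rewrite !mxE eq_lshift.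
Qed.

Lemma dsubmx_free (A : 'M[R]_d) : A \in unitmx -> row_free (dsubmx A).
Proof.
move=> AU; apply/row_freeP; exists (rsubmx (invmx A)).
rewrite mul_dsub_mx mulmx_rsub mulmxV //; apply/matrixP => i j.
by rewrite !mxE eq_rshift.
Qed.

(** The first p columns of e^{-1}, proportional to those of the adjugate, are
orthogonal to the last q rows of e; so are the rows of J G^T, by hypothesis.
Both families have rank p, the dimension of the complement. *)
Lemma cotangent_of_basis (G : 'M[R]_d) (J : 'M[R]_(p, d)) (e : 'M[R]_d) a :
  posdef G -> row_free J -> e \in unitmx -> a != 0 ->
  dsubmx e *m G *m J^T = 0 ->
  (a *: (lsubmx (\adj e))^T :=: orthE (orthG G J))%MS.
Proof.
move=> pG fJ eU a0 eJ.
have det0 : \det e != 0 by rewrite -unitfE -unitmxE.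
pose E := (lsubmx (\adj e))^T.
have adjU : \adj e \in unitmx.
  have : \det e *: 1%:M \in @unitmx R d by rewrite unitmxZ ?unitmx1 ?unitfE.
  by rewrite scalemx1 -mul_mx_adj unitmx_mul => /andP[].
have rE : \rank E = p.
  by apply/eqP; rewrite /E trmx_lsub; apply: usubmx_free; rewrite unitmx_tr.
have rC : \rank (orthE (dsubmx e)) = p.
  by rewrite orthE_rank (eqP (dsubmx_free eU)) addnK.
have EC : (E <= orthE (dsubmx e))%MS.
  apply/sub_kermxP; rewrite /E -trmx_mul mul_dsub_mx mulmx_lsub mul_mx_adj.
  by apply/matrixP => i j; rewrite !mxE eq_rlshift mulr0n.
have JC : (J *m G^T <= orthE (dsubmx e))%MS.
  apply/sub_kermxP.
  have -> : J *m G^T *m (dsubmx e)^T = (dsubmx e *m G *m J^T)^T.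
    by rewrite !trmx_mul trmxK mulmxA.
  by rewrite eJ trmx0.
have rJ : \rank (J *m G^T) = p.
  by rewrite mxrankMfree ?(eqP fJ) // row_free_unit unitmx_tr posdef_unitmx.
have eqC m (B : 'M[R]_(m, d)) : (B <= orthE (dsubmx e))%MS -> \rank B = p ->
    (B :=: orthE (dsubmx e))%MS.
  by move=> BC rB; apply/eqmxP; rewrite -(geq_leqif (mxrank_leqif_eq BC)) rB rC.
apply: (eqmx_trans (eqmx_scale _ a0)); apply: (eqmx_trans (eqC _ _ EC rE)).
apply: (eqmx_trans (eqmx_sym (eqC _ _ JC rJ))); apply: eqmx_sym.
exact: orth_orthGE.
Qed.

End OrthogonalComplements.

Section Gbar.
Context {R : realType} {d : nat}.
Variables (nu : {measure set (borel_rV R d) -> \bar R}) (Theta : set 'rV[R]_d).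
Variable (psi : 'rV[R]_d -> R).

Lemma Gbar_posdef x : full_exponential_family nu Theta psi ->
  (grad psi @` Theta) x -> posdef (Gbar Theta psi x).
Proof.
move=> [_ _ _ fp] Ex; apply: posdef_invmx; apply: fp.
have sT : set_surj Theta (grad psi @` Theta) (grad psi) by [].
by apply: (surjpinv_image_sub (dflt := fun=> 0) sT); exists x.
Qed.

End Gbar.

(** * From vector versions to algebraic versions *)

Section VectorToAlgebraic.
Context {R : realType} {p q : nat}.
Local Notation d := (p + q)%N.
Variables (Theta : set 'rV[R]_d) (psi : 'rV[R]_d -> R).
Variables (U : set 'rV[R]_p) (eta0 : 'rV[R]_p -> 'rV[R]_d).
Hypothesis Gpos : forall u, U u -> posdef (Gbar Theta psi (eta0 u)).
Hypothesis eta0_diff : forall u, U u -> differentiable eta0 u.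
Hypothesis eta0_free : forall u, U u -> row_free (jacobian eta0 u).
Variables (H : 'rV[mpoly.mpoly p R]_d) (e : 'M[mpoly.mpoly p R]_d) (c : R).
Variable f : 'I_p -> mpoly.mpoly q (mpoly.mpoly p R).
Hypothesis data : vector_data Theta psi U eta0 H e f.

Local Notation M u := (evmx u e).

Lemma polyfun_ev n m (x : 'rV[R]_n -> 'rV[R]_m) A :
  (forall i, polyfun (fun z => x z 0 i)) -> polyfun (fun z => ev (x z) A).
Proof. by move=> px; exact: (falg_ev (@polyfun_algebra R n)). Qed.

Lemma vector_versionE u v : U u ->
  vector_version H e c f u v =
  eta0 u + row_mx (c *: \row_j ev2 u v (f j)) v *m M u.
Proof.
move=> Uu; rewrite /vector_version (vector_model data Uu) -addrA; congr (_ + _).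
rewrite mulmx_sum_row big_split_ord /= addrC; congr (_ + _).
  rewrite scaler_sumr; apply: eq_bigr => j _.
  by rewrite row_mxEl !mxE scalerA.
by apply: eq_bigr => k _; rewrite row_mxEr.
Qed.

(** The coordinates of X - eta_u in the basis e(u) are unique, and the last q of
them are v: only the first p equations remain.  They are multiplied by
det e(u), so that the adjugate replaces the inverse. *)
Lemma vector_version_solvable X u : U u ->
  let s := (X - eta0 u) *m \adj (M u) in
  let v := rsubmx ((\det (M u))^-1 *: s) in
  (exists v, X = vector_version H e c f u v) <->
  forall j, lsubmx s 0 j - \det (M u) * (c * ev2 u v (f j)) = 0.
Proof.
move=> Uu s v; have MU := vector_basis data Uu.
have det0 : \det (M u) != 0 by rewrite -unitfE -unitmxE.
have sE : s = \det (M u) *: ((X - eta0 u) *m invmx (M u)).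
  by rewrite /s /invmx MU -scalemxAr scalerA mulfV // scale1r.
split=> [[v' XE] j|eqs].
  have sE' : s = \det (M u) *: row_mx (c *: \row_j ev2 u v' (f j)) v'.
    by rewrite sE {1}XE vector_versionE // addrC addKr mulmxK.
  have -> : v = v' by rewrite /v sE' scalerA mulVf // scale1r row_mxKr.
  by rewrite sE' scale_row_mx row_mxKl !mxE subrr.
exists v; rewrite vector_versionE //.
have -> : row_mx (c *: \row_j ev2 u v (f j)) v = (X - eta0 u) *m invmx (M u).
  have -> : (X - eta0 u) *m invmx (M u) = (\det (M u))^-1 *: s.
    by rewrite sE scalerA mulVf // scale1r.
  rewrite -[RHS]hsubmxK; congr row_mx; apply/rowP => j.
  have := eqs j => /eqP; rewrite subr_eq0 => /eqP E.
  by move: E; rewrite !mxE => ->; rewrite mulKf.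
by rewrite mulmxKV // addrC subrK.
Qed.

(** Large enough for det^(N+1) to clear the denominators of every monomial. *)
Let N := \sum_j mpoly.mmeasure mpoly.mdeg (f j).

Lemma mdeg_le_N j m : m \in mpoly.msupp (f j) -> (mpoly.mdeg m <= N)%N.
Proof.
move=> mf; rewrite /N (bigD1 j) //=.
by have := mpoly.msize_mdeg_lt mf; lia.
Qed.

(** The witnesses are et = det^N times the first p columns of the adjugate and
h_j = - det^(N+1) f_j(u, v), where v is the linear form in X - eta_u given by
the last q columns of the inverse. *)
Lemma algebraic_of_vector :
  exists (et : 'M[mpoly.mpoly (p + d) R]_(p, d))
         (h : 'I_p -> mpoly.mpoly d (mpoly.mpoly (d + (p + d)) R)),
    algebraic_data Theta psi U eta0 et h /\
    forall X u, U u ->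
      (exists v, X = vector_version H e c f u v) <->
      algebraic_version eta0 et c h X u.
Proof.
have pM n (u : 'rV[R]_n -> 'rV[R]_p) : (forall i, polyfun (fun z => u z 0 i)) ->
    forall i j, polyfun (fun z => M (u z) i j).
  by move=> pu i j; under eq_fun do rewrite mxE; exact: polyfun_ev.
have pdet n (u : 'rV[R]_n -> 'rV[R]_p) k :
    (forall i, polyfun (fun z => u z 0 i)) -> polyfun (fun z => \det (M (u z)) ^+ k).
  move=> pu; apply: (falgX (@polyfun_algebra R n)).
  by apply: (falg_det (@polyfun_algebra R n)); exact: pM.
have padj n (u : 'rV[R]_n -> 'rV[R]_p) i j :
    (forall i, polyfun (fun z => u z 0 i)) -> polyfun (fun z => (\adj (M (u z))) i j).
  by move=> pu; apply: (falg_adj (@polyfun_algebra R n)); exact: pM.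
have /choice[et0 Het] : forall ji : 'I_p * 'I_d, exists A : mpoly.mpoly (p + d) R,
    forall z, ev z A = \det (M (lsubmx z)) ^+ N * (\adj (M (lsubmx z))) ji.2 (lshift q ji.1).
  move=> [j i]; apply: polyfun_mpoly.
  have pl k : polyfun (fun z : 'rV[R]_(p + d) => lsubmx z 0 k).
    by under eq_fun do rewrite mxE; exact: polyfun_coord.
  apply: polyfunM.
    exact: pdet.
  exact: padj.
pose et : 'M[mpoly.mpoly (p + d) R]_(p, d) := \matrix_(j, i) et0 (j, i).
pose uu (x : 'rV[R]_(d + (p + d))) := lsubmx (rsubmx x).
pose tau (x : 'rV[R]_(d + (p + d))) := lsubmx x - rsubmx (rsubmx x).
pose B x := rsubmx (\adj (M (uu x))).
pose a j m x := - (ev (uu x) (mpoly.mcoeff m (f j)) * \det (M (uu x)) ^+ (N.+1 - mpoly.mdeg m)).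
have puu i : polyfun (fun x => uu x 0 i).
  by under eq_fun do rewrite !mxE; exact: polyfun_coord.
have /choice[h Hh] : forall j, quadratic_in tau
    (fun x => \sum_(m <- mpoly.msupp (f j)) a j m x * mpoly.mmap1 ((tau x *m B x) 0) m).
  move=> j; apply: quadratic_in_order2.
  - move=> i; under eq_fun do rewrite !mxE.
    by apply: (falgB (@polyfun_algebra R _)); exact: polyfun_coord.
  - by move=> i k; under eq_fun do rewrite mxE; exact: padj.
  - move=> m _; apply: (falgN (@polyfun_algebra R _)).
    by apply: polyfunM; [exact: polyfun_ev|exact: pdet].
  - by move=> m; exact: (vector_order data).
have etE u eta : evmx (row_mx u eta) et = \det (M u) ^+ N *: (lsubmx (\adj (M u)))^T.
  apply/matrixP => j i; rewrite [LHS]mxE [X in ev _ X]mxE Het /= row_mxKl.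
  by rewrite [RHS]mxE; congr (_ * _); rewrite [RHS]mxE [RHS]mxE.
exists et, h; split.
  split=> [u Uu|j]; last exact: (Hh j).1.
  have MU := vector_basis data Uu.
  have detN0 : \det (M u) ^+ N != 0 by rewrite expf_neq0 // -unitfE -unitmxE.
  rewrite etE.
  apply: (cotangent_of_basis (Gpos Uu) (eta0_free Uu) MU detN0).
  apply/matrixP => k b; have := vector_orth data Uu k b.
  rewrite deriveEjacobian; last exact: eta0_diff.
  have -> : row (rshift p k) (M u) = row k (dsubmx (M u)).
    by apply/rowP => i; rewrite !mxE.
  rewrite -rowE tr_row -row_mul colE mulmxA -row_mul -colE => /matrixP/(_ 0 0).
  by rewrite [in X in X -> _]mxE [in X in X -> _]mxE => ->; rewrite !mxE.
move=> X u Uu; rewrite vector_version_solvable //.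
have MU := vector_basis data Uu.
have det0 : \det (M u) != 0 by rewrite -unitfE -unitmxE.
set s := _ *m \adj _.
suff E j : ((X - eta0 u) *m (row j (evmx (row_mx u (eta0 u)) et))^T) 0 0 +
    c * ev2 (row_mx X (row_mx u (eta0 u))) (X - eta0 u) (h j) =
    \det (M u) ^+ N * (lsubmx s 0 j - \det (M u) * (c * ev2 u (rsubmx ((\det (M u))^-1 *: s)) (f j))).
  split=> [eqs eta_u j|eqs j].
    by apply: etrans (E j) _; rewrite eqs mulr0.
  have /eqP := etrans (esym (E j)) (eqs j).
  by rewrite mulf_eq0 expf_eq0 (negbTE det0) andbF => /eqP.
rewrite mulrBr; congr (_ + _).
  rewrite etE /s -mulmx_lsub; move: (lsubmx _) (X - _) (\det _ ^+ N) => A t a'.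
  rewrite !mxE mulr_sumr; apply: eq_bigr => i _; rewrite !mxE; ring.
have -> : X - eta0 u = tau (row_mx X (row_mx u (eta0 u))).
  by rewrite /tau !row_mxKl !row_mxKr.
rewrite (Hh j).2 /a /B /uu /tau !(row_mxKr, row_mxKl).
rewrite mulr_sumr /ev2 /mpoly.mmap !mulr_sumr -sumrN; apply: eq_big_seq => m mf.
have -> : (rsubmx ((\det (M u))^-1 *: s)) 0 =
    (fun k => (\det (M u))^-1 * ((X - eta0 u) *m rsubmx (\adj (M u))) 0 k).
  by apply/funext => k; rewrite linearZ /= /s -mulmx_rsub [LHS]mxE.
rewrite mmap1Z.
have mN := mdeg_le_N mf.
rewrite subSn // exprS -{2}(subnK mN) exprD.
have : \det (M u) ^+ mpoly.mdeg m * (\det (M u))^-1 ^+ mpoly.mdeg m = 1.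
  by rewrite -exprMn mulfV // expr1n.
set x := \det (M u) ^+ (_ - _); set y := _ ^+ mpoly.mdeg m; set y' := _ ^+ mpoly.mdeg m.
move=> yy'; set mon := mpoly.mmap1 _ m; set co := ev u _; move: (\det _) => D.
by transitivity (- (x * (D * (c * (co * mon))) * (y * y'))); [rewrite yy'|]; ring.
Qed.

End VectorToAlgebraic.

(** * Estimators defined by an algebraic version *)

Section Lines.
Context {R : realType}.

Lemma near_line (V : normedModType R) (D : set V) w v : open D -> D w ->
  \forall s \near (0 : R), D (s *: v + w).
Proof.
move=> oD Dw.
have c : {for (0 : R), continuous (fun s : R => s *: v + w)}.
  apply: (@cvgD _ _ _ (nbhs (0 : R))); last exact: cvg_cst.
  exact: scalel_continuous.
by apply: c; rewrite scale0r add0r; exact: open_nbhs_nbhs.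
Qed.

(** A directional derivative sees only the restriction of the function to a line,
so functions on different spaces can be compared; this is how some variables
are frozen below. *)
Lemma derive_line_eq (V V' W : normedModType R) (f : V -> W) (g : V' -> W)
    a v b w :
  (\forall s \near (0 : R), f (s *: v + a) = g (s *: w + b)) ->
  'D_v f a = 'D_w g b.
Proof.
move=> fg; rewrite /derive.
have fgab : f a = g b by have := nbhs_singleton fg; rewrite !scale0r !add0r.
have E : \forall s \near (0 : R),
    s^-1 *: (f (s *: v + a) - f a) = s^-1 *: (g (s *: w + b) - g b).
  by apply: filterS fg => s ->; rewrite fgab.
congr (lim _); rewrite eqEsubset; split; apply: near_eq_cvg; apply: cvg_within.
  by apply: filterS E => s ->.
by apply: filterS E => s ->.
Qed.

Lemma delta_mx_lshift m n (a : 'I_m) :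
  delta_mx 0 (lshift n a) = row_mx (delta_mx 0 a) 0 :> 'rV[R]_(m + n).
Proof.
by apply/rowP => i; case: (split_ordP i) => j ->;
  rewrite ?row_mxEl ?row_mxEr !mxE ?eq_lshift ?eq_rlshift ?andbF.
Qed.

Lemma delta_mx_rshift m n (k : 'I_n) :
  delta_mx 0 (rshift m k) = row_mx 0 (delta_mx 0 k) :> 'rV[R]_(m + n).
Proof.
by apply/rowP => i; case: (split_ordP i) => j ->;
  rewrite ?row_mxEl ?row_mxEr !mxE ?eq_rshift ?eq_lrshift ?andbF.
Qed.

Lemma derive_affine m n (B : 'M[R]_(m, n)) k (L : 'rV[R]_m -> R) x :
  (forall y, L y - L x = ((y - x) *m B) 0 k) ->
  differentiable L x /\ forall v, 'D_v L x = (v *m B) 0 k.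
Proof.
move=> HL.
have [|||dL DL] := @product_difference R _ m L (fun i (y : 'rV[R]_m) => y 0 i)
  (fun i _ => B i k) x.
- by move=> i; exact: differentiable_coord.
- by move=> i; exact: (falg_cst (continuous_algebra _)).
- by near=> y; rewrite HL mxE; apply: eq_bigr => i _; rewrite !mxE.
split=> // v; rewrite DL mxE; apply: eq_bigr => i _.
by rewrite derive_coordinate.
Unshelve. all: by end_near. Qed.

End Lines.

Section AlgebraicVersion.
Context {R : realType} {p q : nat}.
Local Notation d := (p + q)%N.
Variables (Theta : set 'rV[R]_d) (psi : 'rV[R]_d -> R).
Variables (U : set 'rV[R]_p) (eta0 : 'rV[R]_p -> 'rV[R]_d).
Hypothesis Gpos : forall u, U u -> posdef (Gbar Theta psi (eta0 u)).
Hypotheses (oU : open U) (smooth_eta0 : smooth_on U eta0).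
Hypothesis eta0_free : forall u, U u -> row_free (jacobian eta0 u).
Variables (et : 'M[mpoly.mpoly (p + d) R]_(p, d)) (c : R).
Variable h : 'I_p -> mpoly.mpoly d (mpoly.mpoly (d + (p + d)) R).
Hypothesis data : algebraic_data Theta psi U eta0 et h.

Let E u := evmx (row_mx u (eta0 u)) et.

Definition algebraic_lhs u j (X : 'rV[R]_d) : R :=
  ((X - eta0 u) *m (row j (E u))^T) 0 0
  + c * ev2 (row_mx X (row_mx u (eta0 u))) (X - eta0 u) (h j).

(** The term in h_j is quadratic in X - eta_u. *)
Lemma derive_algebraic_lhs u j :
  differentiable (algebraic_lhs u j) (eta0 u) /\
  forall v, 'D_v (algebraic_lhs u j) (eta0 u) = (v *m (E u)^T) 0 j.
Proof.
pose L (X : 'rV[R]_d) := ((X - eta0 u) *m (row j (E u))^T) 0 0.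
have [|dL DL] := @derive_affine _ _ _ (E u)^T j L (eta0 u).
  move=> X; rewrite /L subrr mul0mx [X in _ - X]mxE subr0 [LHS]mxE [RHS]mxE.
  by apply: eq_bigr => i _; rewrite !mxE.
have [||||dQ DQ] := @derive_order2 R _ _ _
  (fun X => row_mx X (row_mx u (eta0 u))) (fun X => X - eta0 u) (h j) (eta0 u).
- exact: homogeneous_order_ge (algebraic_homogeneous data j).
- move=> i; apply: (falg_row_mx (S := fun f => {for eta0 u, continuous f})
                      (x := id) (y := fun=> row_mx u (eta0 u))) => k.
    exact: coord_continuous.
  exact: (falg_cst (continuous_algebra _)).
- move=> i; apply: (differentiable_coord_comp (f := fun X => X - eta0 u)).
  by apply: differentiableB.
- exact: subrr.
have dQ' : differentiable (c *: (fun X : 'rV[R]_d =>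
  ev2 (row_mx X (row_mx u (eta0 u))) (X - eta0 u) (h j))) (eta0 u).
  exact: differentiableZ.
split; first exact: (differentiableD dL dQ').
move=> v; rewrite /algebraic_lhs.
rewrite [LHS](deriveD (f := L) (diff_derivable dL) (diff_derivable dQ')).
rewrite deriveZ ?DQ ?scaler0 ?addr0; last exact: diff_derivable.
exact: DL.
Unshelve. all: by end_near. Qed.

Lemma algebraic_lhs_eta0 u j : algebraic_lhs u j (eta0 u) = 0.
Proof.
rewrite /algebraic_lhs subrr mul0mx mxE add0r ev2_order_ge1 ?mulr0 // => m mh.
exact/ltnW/(homogeneous_order_ge (algebraic_homogeneous data j) mh).
Qed.

(** The equations hold along the line only, which is enough. *)
Lemma derive_solution n (xi : 'rV[R]_n -> 'rV[R]_d) w v u :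
  differentiable xi w -> xi w = eta0 u ->
  (\forall s \near (0 : R), forall j, algebraic_lhs u j (xi (s *: v + w)) = 0) ->
  'D_v xi w *m (E u)^T = 0.
Proof.
move=> dxi xiw H; apply/rowP => j; rewrite [RHS]mxE.
have [dF <-] := derive_algebraic_lhs u j.
have dF' : differentiable (algebraic_lhs u j) (xi w) by rewrite xiw.
have -> : 'D_('D_v xi w) (algebraic_lhs u j) (eta0 u) =
    'D_v (algebraic_lhs u j \o xi) w.
  rewrite [RHS]deriveE; last exact: differentiable_comp.
  rewrite diff_comp // [RHS]/= xiw (deriveE _ dF); congr ('d _ _ _).
  exact: deriveE.
rewrite (@derive_line_eq _ _ _ _ _ (fun=> 0) _ _ w v).
  exact: derive_cst.
by apply: filterS H => s; apply.
Qed.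


Section Derivatives.
Variables (D : set 'rV[R]_d) (eta : 'rV[R]_d -> 'rV[R]_d) (u : 'rV[R]_p).
Hypotheses (oD : open D) (Du : D (row_mx u 0)).
Hypothesis eta_extends : forall u, D (row_mx u 0) -> eta (row_mx u 0) = eta0 u.

Lemma derive_tangent a :
  'D_(delta_mx 0 (lshift q a)) eta (row_mx u 0) = 'D_(delta_mx 0 a) eta0 u.
Proof.
apply: derive_line_eq.
have := near_line (delta_mx 0 (lshift q a)) oD Du; apply: filterS => s.
rewrite delta_mx_lshift scale_row_mx add_row_mx scaler0 addr0.
exact: eta_extends.
Qed.

Lemma derive_transversal k :
  differentiable eta (row_mx u 0) ->
  (forall v, D (row_mx u v) -> algebraic_version eta0 et c h (eta (row_mx u v)) u) ->
  'D_(delta_mx 0 (rshift p k)) eta (row_mx u 0) *m (E u)^T = 0.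
Proof.
move=> deta H; apply: derive_solution => //; first exact: eta_extends.
have := near_line (delta_mx 0 (rshift p k)) oD Du; apply: filterS => s.
rewrite delta_mx_rshift scale_row_mx add_row_mx scaler0 add0r addr0 => Ds j.
exact: H.
Qed.

End Derivatives.

(** The transversal derivatives are orthogonal to E, hence Gbar-orthogonal to the
tangent derivatives. *)
Theorem algebraic_efficient u0 D eta :
  defined_by_algebraic U u0 eta0 et c h D eta ->
  first_order_efficient Theta psi D eta.
Proof.
move=> [est eqs] u Du k a; have Uu := estimator_dom est Du.
have oD := estimator_open est; have ext := estimator_extends est.
have deta : differentiable eta (row_mx u 0).
  by have [+ _] := estimator_smooth est 1%N; exact.
have deta0 : differentiable eta0 u by have [+ _] := smooth_eta0 1%N; exact.
rewrite /fisher_mixed ext // (derive_tangent oD Du ext).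
rewrite (deriveEjacobian _ deta0) trmx_mul mulmxA.
rewrite (cotangent_orth (algebraic_span data Uu)) ?mul0mx ?mxE //.
by apply: (derive_transversal oD Du ext) => // v; exact: eqs.
Qed.

(** The coordinates v are (X - eta_u) N^T, where the rows of N complete those of
E at u0 to a basis. *)
Theorem algebraic_estimator u0 : U u0 -> exists D eta,
  defined_by_algebraic U u0 eta0 et c h D eta.
Proof.
move=> Uu0; pose J0 := jacobian eta0 u0; pose G0 := Gbar Theta psi (eta0 u0).
have span0 := algebraic_span data Uu0.
have JE : J0 *m (E u0)^T \in unitmx.
  exact: cotangent_tangent_unitmx (Gpos Uu0) (eta0_free Uu0) span0.
have [N EN] := row_free_complete
  (cotangent_free (Gpos Uu0) (eta0_free Uu0) span0).
(* A point z is (X, ((u, eta_u), v)). *)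
pose par (z : 'rV[R]_(d + (p + d + q))) := lsubmx (rsubmx z).
pose tau (z : 'rV[R]_(d + (p + d + q))) := lsubmx z - rsubmx (par z).
pose Fj (z : 'rV[R]_(d + (p + d + q))) j :=
  (tau z *m (row j (evmx (par z) et))^T) 0 0
  + c * ev2 (row_mx (lsubmx z) (par z)) (tau z) (h j).
pose P z := row_mx (\row_j Fj z j) (tau z *m N^T - rsubmx (rsubmx z)).
pose D0 := [set w : 'rV[R]_d | U (lsubmx w)].
pose Y (w : 'rV[R]_d) := row_mx (row_mx (lsubmx w) (eta0 (lsubmx w))) (rsubmx w).
pose w0 : 'rV[R]_d := row_mx u0 0.
have PE X w : P (row_mx X (Y w)) =
    row_mx (\row_j algebraic_lhs (lsubmx w) j X)
           ((X - eta0 (lsubmx w)) *m N^T - rsubmx w).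
  by rewrite /P /Fj /tau /par !(row_mxKl, row_mxKr).
have polyP j : polyfun (fun z => P z 0 j).
  have HS := @polyfun_algebra R (d + (p + d + q)).
  have ppar i : polyfun (fun z => par z 0 i).
    by under eq_fun do rewrite !mxE; exact: polyfun_coord.
  have pl i : polyfun (fun z : 'rV[R]_(d + (p + d + q)) => lsubmx z 0 i).
    by under eq_fun do rewrite !mxE; exact: polyfun_coord.
  have ptau i : polyfun (fun z => tau z 0 i).
    under eq_fun do rewrite [tau _ _ _]mxE [X in _ + X]mxE.
    apply: (falgB HS) => //; under eq_fun do rewrite !mxE.
    exact: polyfun_coord.
  case: (split_ordP j) => k ->.
    under eq_fun do rewrite row_mxEl mxE; apply: polyfunD.
      apply: (falg_mulmx HS) => [i l|i l]; first by rewrite ord1.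
      under eq_fun do rewrite !mxE; exact: (falg_ev HS).
    apply: polyfunM; first exact: polyfun_cst.
    by apply: (falg_ev2 HS) => // i; exact: falg_row_mx.
  under eq_fun do rewrite row_mxEr mxE; apply: polyfunD.
    apply: (falg_mulmx HS) => [i l|i l]; first by rewrite ord1.
    exact: polyfun_cst.
  under eq_fun do rewrite mxE; apply: (falgN HS).
  by under eq_fun do rewrite !mxE; exact: polyfun_coord.

have cl : continuous (lsubmx : 'rV[R]_d -> 'rV[R]_p).
  by move=> w; apply: differentiable_continuous; exact: differentiable_lsubmx.
have oD0 : open D0 by apply: open_comp => // w _; exact: cl.
have D0w0 : D0 w0 by rewrite /D0 /= row_mxKl.
have smoothY : smooth_on D0 Y.
  move=> k; apply/(C_on_row oD0).
  have Cid i : C_on k D0 (fun w : 'rV[R]_d => w 0 i).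
    apply: ((C_on_row oD0 k id).2 _ i).
    by apply: (@C_on_linear _ _ _ k D0 idfun) => w; exact: cvg_id.
  have Ceta : C_on k D0 (fun w => eta0 (lsubmx w)).
    exact: (@C_on_comp_linear _ _ _ _ k U lsubmx eta0 oU cl (smooth_eta0 k)).
  move=> i; apply: (falg_row_mx (S := C_on k D0)) => j; last first.
    by under eq_fun do rewrite mxE; exact: Cid.
  apply: (falg_row_mx (S := C_on k D0)) => l.
    by under eq_fun do rewrite mxE; exact: Cid.
  exact: (C_on_row oD0 k _).2 Ceta l.
have P0 : P (row_mx (eta0 u0) (Y w0)) = 0.
  rewrite PE row_mxKl row_mxKr subrr mul0mx subrr -[RHS]row_mx0; congr row_mx.
  by apply/rowP => j; rewrite !mxE algebraic_lhs_eta0.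
have Junit : \matrix_(i < d, j < d)
    'D_(delta_mx 0 (lshift (p + d + q) i)) (fun z => P z 0 j)
      (row_mx (eta0 u0) (Y w0)) \in unitmx.
  suff -> : \matrix_(i < d, j < d)
    'D_(delta_mx 0 (lshift (p + d + q) i)) (fun z => P z 0 j)
      (row_mx (eta0 u0) (Y w0)) = (col_mx (E u0) N)^T by rewrite unitmx_tr.
  apply/matrixP => i j; rewrite [LHS]mxE.
  rewrite (@derive_line_eq _ _ _ _ _ (fun X => P (row_mx X (Y w0)) 0 j) _ _
             (eta0 u0) (delta_mx 0 i)); last first.
    near=> s; rewrite delta_mx_lshift scale_row_mx add_row_mx scaler0 add0r //.
  under eq_fun do rewrite PE.
  rewrite tr_col_mx; case: (split_ordP j) => k ->.
    under eq_fun do rewrite row_mxEl mxE row_mxKl.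
    have [_ ->] := derive_algebraic_lhs u0 k.
    by rewrite -rowE [LHS]mxE row_mxEl.
  under eq_fun do rewrite row_mxEr row_mxKl row_mxKr.
  have [|_ ->] := @derive_affine _ _ _ N^T k
     (fun X => ((X - eta0 u0) *m N^T - 0) 0 k) (eta0 u0).
    by move=> X; rewrite subrr mul0mx !subr0 [X in _ - X]mxE subr0.
  by rewrite -rowE [LHS]mxE row_mxEr.
have [D1 [r [X [[oD1 D1w0 D10 r0 sX] [Xw0 PX uniqX]]]]] :=
  implicit_polynomial_function polyP oD0 D0w0 smoothY P0 Junit.

(* On V the point eta_u lies in the ball of uniqueness, which gives
   X(u, 0) = eta_u. *)
pose V := D1 `&` [set w | `|eta0 (lsubmx w) - eta0 u0| <= r].
pose D2 := interior V.
have oD2 : open D2 by exact: open_interior.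
have D21 w : D2 w -> D1 w by move=> /interior_subset [].
have D2U w : D2 w -> U (lsubmx w) by move=> /D21 /D10.
have D2w0 : D2 w0.
  have ceta : {for w0, continuous (fun w : 'rV[R]_d => eta0 (lsubmx w))}.
    apply: (@continuous_comp _ _ _ lsubmx eta0); first exact: cl.
    by apply: (smooth_eta0 0%N); rewrite row_mxKl.
  have /cvgrPdist_le /(_ _ r0) Hr := ceta.
  apply: filterI; first exact: (open_near oD1 D1w0).
  by apply: filterS Hr => w; rewrite row_mxKl distrC.
have XE w : D2 w -> forall j, algebraic_lhs (lsubmx w) j (X w) = 0.
  move=> /D21 D1w j; have := PX w D1w; rewrite PE => /(congr1 lsubmx).
  by rewrite row_mxKl => /rowP/(_ j); rewrite mxE => ->; rewrite !mxE.
have XN w : D2 w -> (X w - eta0 (lsubmx w)) *m N^T = rsubmx w.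
  move=> /D21 D1w; have := PX w D1w; rewrite PE => /(congr1 rsubmx).
  by rewrite row_mxKr linear0 => /eqP; rewrite subr_eq0 => /eqP.
have ext u : D2 (row_mx u 0) -> X (row_mx u 0) = eta0 u.
  move=> D2u; have [D1u] := interior_subset D2u; rewrite /= row_mxKl => ru.
  apply/esym; apply: uniqX => //.
  rewrite PE row_mxKl row_mxKr subrr mul0mx subrr -[RHS]row_mx0; congr row_mx.
  by apply/rowP => j; rewrite !mxE algebraic_lhs_eta0.
have eqs u v : D2 (row_mx u v) -> algebraic_version eta0 et c h (X (row_mx u v)) u.
  by move=> D2uv eta_u j; have := XE _ D2uv j; rewrite row_mxKl.
have sX2 : smooth_on D2 X by move=> k; exact: C_on_sub D21 (sX k).
have dX w : D2 w -> differentiable X w by have [+ _] := sX2 1%N; exact.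
have deta0 : differentiable eta0 u0 by have [+ _] := smooth_eta0 1%N; exact.
have JacU : jacobian X w0 \in unitmx.
  have dXw0 := dX _ D2w0.
  have upJ : usubmx (jacobian X w0) = J0.
    apply/matrixP => a j; rewrite [LHS]mxE jacobian_entry // (derive_tangent oD2 D2w0 ext).
    by rewrite -jacobian_entry.
  have rowD k : row k (dsubmx (jacobian X w0)) = 'D_(delta_mx 0 (rshift p k)) X w0.
    by apply/rowP => j; rewrite [LHS]mxE [LHS]mxE jacobian_entry.
  have downE : dsubmx (jacobian X w0) *m (E u0)^T = 0.
    apply/row_matrixP => k; rewrite row0 row_mul rowD.
    by apply: (derive_transversal oD2 D2w0 ext) => // v; exact: eqs.
  have downN : dsubmx (jacobian X w0) *m N^T = 1%:M.
    apply/row_matrixP => k; apply/rowP => l; rewrite row_mul rowD.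
    pose L X := ((X - eta0 u0) *m N^T) 0 l.
    have [|dL DL] := @derive_affine _ _ _ N^T l L (eta0 u0).
      have L0 : L (eta0 u0) = 0 by rewrite /L subrr mul0mx mxE.
      by move=> x; rewrite L0 subr0.
    have Xw0' : X w0 = eta0 u0 by [].
    have dL' : differentiable L (X w0) by rewrite Xw0'.
    rewrite -DL (deriveE _ dL) (deriveE _ dXw0) -Xw0'.
    rewrite -[LHS]/(('d L (X w0) \o 'd X w0) _) -diff_comp // -deriveE; last first.
      exact: differentiable_comp.
    rewrite (@derive_line_eq _ _ _ _ _ (fun w : 'rV[R]_d => w 0 (rshift p l)) _ _
               w0 (delta_mx 0 (rshift p k))); last first.
      have := near_line (delta_mx 0 (rshift p k)) oD2 D2w0; apply: filterS => s.
      move=> Ds; have := XN _ Ds.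
      have -> : lsubmx (s *: delta_mx 0 (rshift p k) + w0) = u0.
        by rewrite delta_mx_rshift scale_row_mx add_row_mx row_mxKl scaler0 add0r.
      by rewrite /L /= => ->; rewrite mxE.
    by rewrite derive_coordinate !mxE eqxx eq_rshift eq_sym.
  (* This product is block triangular, with diagonal blocks J0 E^T and 1. *)
  have : jacobian X w0 *m (col_mx (E u0) N)^T \in unitmx.
    rewrite -(vsubmxK (jacobian X w0)) upJ tr_col_mx mul_col_row downE downN.
    by rewrite unitmxE det_ublock det1 mulr1 -unitmxE.
  by rewrite unitmx_mul => /andP[].
have [D [oD Dw0 DD2 injX unitX]] := local_diffeomorphism oD2 D2w0 (sX2 1%N) JacU.
exists D, X; split; last by move=> u v /DD2; exact: eqs.
split=> //.
- by move=> u v /DD2/D2U; rewrite row_mxKl.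
- by move=> k; exact: C_on_sub DD2 (sX2 k).
- by move=> u /DD2; exact: ext.
Unshelve. all: by end_near. Qed.

End AlgebraicVersion.

(** * First-order efficiency and the equivalence of the two versions *)

Theorem theorem5 (R : realType) (p q : nat) (p_lt_d : (p < p + q)%N)
    (nu : {measure set (borel_rV R (p + q)) -> \bar R})
    (Theta : set 'rV[R]_(p + q)) (psi : 'rV[R]_(p + q) -> R)
    (VE : set 'rV[R]_(p + q)) (U : set 'rV[R]_p) (u0 : 'rV[R]_p)
    (eta0 : 'rV[R]_p -> 'rV[R]_(p + q)) :
  full_exponential_family nu Theta psi ->
  U u0 ->
  algebraic_curved_family Theta psi VE (eta0 u0) ->
  regular_parametrization VE U eta0 ->
  [/\ (* (i) *)
      forall (H : 'rV[mpoly.mpoly p R]_(p + q))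
             (e : 'M[mpoly.mpoly p R]_(p + q)) (c : R)
             (f : 'I_p -> mpoly.mpoly q (mpoly.mpoly p R))
             (D : set 'rV[R]_(p + q)),
        vector_data Theta psi U eta0 H e f ->
        estimator U u0 eta0 D (vector_version_map H e c f) ->
        first_order_efficient Theta psi D (vector_version_map H e c f),
      (* (ii) *)
      forall (H : 'rV[mpoly.mpoly p R]_(p + q))
             (e : 'M[mpoly.mpoly p R]_(p + q)) (c : R)
             (f : 'I_p -> mpoly.mpoly q (mpoly.mpoly p R))
             (D : set 'rV[R]_(p + q)),
        vector_data Theta psi U eta0 H e f ->
        estimator U u0 eta0 D (vector_version_map H e c f) ->
        exists (et : 'M[mpoly.mpoly (p + (p + q)) R]_(p, p + q))
               (h : 'I_p -> mpoly.mpoly (p + q)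
                      (mpoly.mpoly ((p + q) + (p + (p + q))) R)),
          algebraic_data Theta psi U eta0 et h /\
          forall (X : 'rV[R]_(p + q)) (u : 'rV[R]_p), U u ->
            (exists v : 'rV[R]_q, X = vector_version H e c f u v) <->
            algebraic_version eta0 et c h X u &
      (* (iii) *)
      forall (et : 'M[mpoly.mpoly (p + (p + q)) R]_(p, p + q)) (c : R)
             (h : 'I_p -> mpoly.mpoly (p + q)
                    (mpoly.mpoly ((p + q) + (p + (p + q))) R)),
        algebraic_data Theta psi U eta0 et h ->
        (exists (D : set 'rV[R]_(p + q)) (eta : 'rV[R]_(p + q) -> 'rV[R]_(p + q)),
           defined_by_algebraic U u0 eta0 et c h D eta) /\
        (forall (D : set 'rV[R]_(p + q)) (eta : 'rV[R]_(p + q) -> 'rV[R]_(p + q)),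
           defined_by_algebraic U u0 eta0 et c h D eta ->
           first_order_efficient Theta psi D eta)].

Proof.
move=> fam Uu0 [VEsub _ _ _] [oU smooth0 free0 _ onto].
have Gpos u : U u -> posdef (Gbar Theta psi (eta0 u)).
  move=> Uu; apply: Gbar_posdef fam _; apply: VEsub.
  have [W [_ UW]] := onto _ oU (@subset_refl _ U).
  have : (eta0 @` U) (eta0 u) by exists u.
  by rewrite UW => -[].
have deta0 u : U u -> differentiable eta0 u by have [+ _] := smooth0 1%N; exact.
have vector_algebraic H e c f := algebraic_of_vector Gpos deta0 free0 (H := H) (e := e) c (f := f).
split.
- move=> H e c f D vdata est.
  have [et [h [adata equiv]]] := vector_algebraic H e c f vdata.
  apply: (algebraic_efficient smooth0 adata (u0 := u0) (c := c)).
  split=> // u v Duv; apply/equiv; first exact: (estimator_dom est Duv).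
  by exists v; rewrite /vector_version_map row_mxKl row_mxKr.
- by move=> H e c f D vdata _; exact: vector_algebraic.
- move=> et c h adata; split; first exact: (algebraic_estimator Gpos oU smooth0 free0 c adata Uu0).
  by move=> D eta; exact: (algebraic_efficient smooth0 adata).
Qed.
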